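(* Let $f:L^2(0,T)\to\mathbb{R}$ and $J=f+\mathrm{TGV}$ on $\mathrm{BV}(0,T)$ satisfy: (A1) $f$ is continuously Fréchet differentiable; (A2) there is $L_f>0$ with $\|\nabla f(u_1)-\nabla f(u_2)\|_{L^2}\le L_f\|u_1-u_2\|_{L^2}$ for all $u_1,u_2\in L^2(0,T)$; (A3) there is $C_f>0$ with $f(u)\ge-C_f$ for all $u\in L^2(0,T)$; (A4) the sublevel sets of $J$ are bounded in $\mathrm{BV}(0,T)$. Let $\{u_k\}_{k\ge1}$ be generated by the algorithm described in the context, assumed not to terminate after finitely many iterations. Let $C>0$ be such that $\max\{\|u_k\|_{L^2},M_0\|\widehat u_k\|_{L^2}\}\le C$ for all $k\ge1$, where $M_0=f(0)+C_f$. Then, for all $k\ge1$, $$\min_{1\le j\le k}\Psi(u_j)+\min_{1\le j\le k}\left|\sum_{i=1}^{N_j}\lambda_i^j-\mathrm{TGV}(u_j)\right|\le\sqrt{\frac{8L_fC^2\,\widehat r_J(u_1)}{k}} .$$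
   Context: $T>0$, $\alpha,\beta>0$ fixed. $C_0(0,T)$: continuous functions on $(0,T)$ vanishing at the boundary, uniform norm $\|\cdot\|_C$; $M(0,T)=C_0(0,T)^*$ with dual norm $\|\cdot\|_M$; $\mathrm{BV}(0,T)$: functions $u\in L^1(0,T)$ with $Du\in M(0,T)$, norm $\|u\|_{L^1}+\|Du\|_M$. $\mathrm{TGV}(u)=\sup\{\int_0^Tuv''\,|\,v\in C_c^\infty(0,T),\|v\|_C\le\alpha,\|v'\|_C\le\beta\}=\inf_{w\in\mathrm{BV}(0,T)}\alpha\|Du-w\|_M+\beta\|Dw\|_M$. $\mathcal{L}$: affine functions $x\mapsto cx+d$. $S_{x}=1_{(x,T)}$; $K_{x}(y)=1_{(0,x)}(y)(x-y)$ if $x<T/2$, $K_{x}(y)=1_{(x,T)}(y)(y-x)$ if $x\ge T/2$. $\operatorname{Ext}B:=\{\pm S_x/\alpha\,|\,x\in(0,T)\}\cup\{\pm K_x/\beta\,|\,x\in(\beta/\alpha,T-\beta/\alpha)\}$. $\nabla f(u)\in L^2(0,T)$: Riesz representative of the Fréchet derivative. For a finite ordered set $\mathcal{A}=\{v_j\}_{j=1}^N\subset\operatorname{Ext}B$, let $\mathcal{P}(\mathcal{A})$ be the problem $\min_{\lambda\in\mathbb{R}_+^N,\,\ell\in\mathcal{L}}\big[f(\sum_{j=1}^N\lambda_jv_j+\ell)+\sum_{j=1}^N\lambda_j\big]$. Algorithm. Input: a finite set $\mathcal{A}_0=\{u_j^0\}_{j=1}^{N_0}\subset\operatorname{Ext}B$.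 Compute a minimizer of $\mathcal{P}(\mathcal{A}_0)$, let $u_1$ be the corresponding function $\sum_j\lambda_ju_j^0+\ell$, and obtain $\mathcal{A}_1$ from $\mathcal{A}_0$ by removing all elements with zero weight. For $k=1,2,\dots$: write $\mathcal{A}_k=\{u_j^k\}_{j=1}^{N_k}$ and $u_k=\sum_{j=1}^{N_k}\lambda_j^ku_j^k+\ell^k$, where $(\lambda^k,\ell^k)$ consists of the remaining (positive) weights and the affine part of the previously computed minimizer (it is a minimizer of $\mathcal{P}(\mathcal{A}_k)$). Set $p_k(x)=\int_0^x\nabla f(u_k)(s)\,ds$, $P_k(x)=-\int_0^xp_k(s)\,ds$ and choose $\hat x_k^S,\hat x_k^K\in(0,T)$ with $|p_k(\hat x_k^S)|=\|p_k\|_C$, $|P_k(\hat x_k^K)|=\|P_k\|_C$. If $\|p_k\|_C\le\alpha$ and $\|P_k\|_C\le\beta$, terminate. Otherwise set $\widehat u_k=(\operatorname{sign}(p_k(\hat x_k^S))/\alpha)S_{\hat x_k^S}$ if $\|p_k\|_C/\alpha\ge\|P_k\|_C/\beta$ and $\widehat u_k=(\operatorname{sign}(P_k(\hat x_k^K))/\beta)K_{\hat x_k^K}$ else; let $\mathcal{A}_k^+=\mathcal{A}_k\cup\{\widehat u_k\}$, compute a minimizer of $\mathcal{P}(\mathcal{A}_k^+)$, let $u_{k+1}$ be the corresponding function, and obtain $\mathcal{A}_{k+1}$ from $\mathcal{A}_k^+$ by removing all elements with zero weight. Constraint violation: $\Psi(u_k)=M_0\big(\max\{\|p_k\|_C/\alpha,\|P_k\|_C/\beta\}-1\big)$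 with $M_0=f(0)+C_f$. Residual: $\widehat r_J(u_k)=f(u_k)+\sum_{j=1}^{N_k}\lambda_j^k-\min_{u\in\mathrm{BV}(0,T)}J(u)$ (the minimum exists under (A1)–(A4)).
   Formalization: TGV is taken to be inf over w in BV of α‖Du−w‖_M + β‖Dw‖_M; the sup formula also printed for TGV has the bounds on v and v' interchanged (it gives β instead of α for u = S_x) and is not used. *)

(* Defs.v *)
From HB Require Import structures.
From mathcomp Require Import all_boot all_order all_algebra finmap.
From mathcomp Require Import all_classical all_reals all_analysis measurable_realfun.

Set Implicit Arguments.
Unset Strict Implicit.
Unset Printing Implicit Defensive.

Import Order.TTheory GRing.Theory Num.Theory.
Import numFieldNormedType.Exports.

Local Open Scope classical_set_scope.
Local Open Scope ring_scope.

(* The Hilbert space L^2(mu) as a normed module, on the type of ae-classes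
   [LspaceType2 mu].  A class coerces to (one of) its representatives. *)
Section L2_space.
Context d (X : measurableType d) (R : realType).
Variable mu : {measure set X -> \bar R}.

Local Notation Lf := (LfunType mu (@lee1n R 2)).
Local Notation L2 := (LspaceType2 mu).

Lemma ae_eq_Lnorm2 (u v : X -> R) : measurable_fun setT u ->
  measurable_fun setT v -> (\forall x \ae mu, u x = v x) ->
  'N[mu]_2%:E[EFin \o u]%E = 'N[mu]_2%:E[EFin \o v]%E.
Proof.
move=> mU mV uv; rewrite unlock /Lnorm; congr (_ `^ _)%E.
apply: ae_eq_integral => //=.
- apply/measurable_EFinP; apply: (measurableT_comp (measurable_powR _)).
  exact: measurableT_comp.
- apply/measurable_EFinP; apply: (measurableT_comp (measurable_powR _)).
  exact: measurableT_comp.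
by apply: filterS uv => x /= -> _.
Qed.

(* [LspaceType2] is built on functions with values in [measurableTypeR R], while
   [LfunType] uses [R]; the two are convertible but not unifiable. *)
Definition mfun_of_Lfun (u : Lf) : X -> measurableTypeR R := u.

Lemma mfun_of_Lfun_subproof u : measurable_fun setT (mfun_of_Lfun u).
Proof. exact: (@measurable_funPT _ _ X R u). Qed.

HB.instance Definition _ u := isMeasurableFun.Build _ _ X (measurableTypeR R)
  (mfun_of_Lfun u) (@mfun_of_Lfun_subproof u).

Local Notation pi u := (\pi_{mfun_ mu, X >-> measurableTypeR R}%qT
  (mfun_of_Lfun u : {mfun X >-> measurableTypeR R})).

Lemma repr_pi_ae (u : Lf) : \forall x \ae mu, repr (pi u) x = u x.
Proof.
have /eqP : \pi_{mfun_ mu, X >-> measurableTypeR R}%qT (repr (pi u)) = pi u.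
  by rewrite reprK.
by rewrite eqmodE => /asboolP; apply: filterS => x /(_ I).
Qed.

Lemma L2class_subproof (u : Lf) : finite_norm mu 2%:E (repr (pi u)).
Proof.
rewrite /finite_norm (@ae_eq_Lnorm2 _ u) //; first exact: Lfunction_finite.
  exact: (@measurable_funPT _ _ X (measurableTypeR R)).
exact: repr_pi_ae.
Qed.

Definition L2class (u : Lf) : L2 :=
  LebesgueSpace.Pack (LebesgueSpace.Class
    (isFinLebesgue.Axioms_ _ _ _ _ _ _ (L2class_subproof u))).

Lemma Lfun_L2 (x : L2) : (x : X -> R) \in Lfun mu 2%:E.
Proof.
rewrite inE; apply/andP; split; rewrite inE/=.
  exact: (@measurable_funPT _ _ X (measurableTypeR R)).
exact: Lebesgue_finite.
Qed.

Definition L2repr (x : L2) : Lf := Lfun_Sub (lee1n 2) (Lfun_L2 x).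

Lemma L2_ae_eqP (x y : L2) : x = y <-> \forall t \ae mu, x t = y t.
Proof.
split=> [->|]; first exact: aeW.
case: x y => [x [[px]]] [y [[py]]] /= xy.
have {}xy : x = y.
  rewrite -[x]reprK -[y]reprK; apply/eqP; rewrite eqmodE; apply/asboolP.
  by apply: filterS xy => t + _.
by case: _ / xy py => py; rewrite (Prop_irrelevance px py).
Qed.

Lemma L2classE (u : Lf) : \forall t \ae mu, L2class u t = u t.
Proof. exact: repr_pi_ae. Qed.

Lemma L2classP (u v : Lf) :
  L2class u = L2class v <-> \forall t \ae mu, u t = v t.
Proof.
rewrite L2_ae_eqP; split=> [|uv].
  by apply: filterS3 (L2classE u) (L2classE v) => t -> ->.
by apply: filterS3 (L2classE u) (L2classE v) uv => t -> ->.
Qed.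

Lemma L2reprK : cancel L2repr L2class.
Proof. by move=> x; apply/L2_ae_eqP; exact: L2classE. Qed.

HB.instance Definition _ := gen_eqMixin L2.
HB.instance Definition _ := gen_choiceMixin L2.

Let zero : L2 := L2class 0.
Let opp (x : L2) : L2 := L2class (- L2repr x).
Let add (x y : L2) : L2 := L2class (L2repr x + L2repr y).
Let scale (a : R) (x : L2) : L2 := L2class (a *: L2repr x).

Let addE x y : \forall t \ae mu, add x y t = x t + y t.
Proof. exact: L2classE. Qed.

Let addA : associative add.
Proof.
move=> x y z; apply/L2_ae_eqP.
apply: filterS2 (filterI (addE x y) (addE (add x y) z))
  (filterI (addE y z) (addE x (add y z))) => t [xy xy_z] [yz xyz'].
by rewrite xyz' yz xy_z xy addrA.
Qed.

Let addC : commutative add.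
Proof. by move=> x y; rewrite /add addrC. Qed.

Let add0 : left_id zero add.
Proof.
move=> x; apply/L2_ae_eqP.
by apply: filterS2 (addE zero x) (L2classE 0) => t -> ->; rewrite add0r.
Qed.

Let addN : left_inverse zero opp add.
Proof.
move=> x; apply/L2_ae_eqP.
apply: filterS3 (addE (opp x) x) (L2classE 0) (L2classE (- L2repr x)).
by move=> t -> -> ->; rewrite addNr.
Qed.

HB.instance Definition _ := GRing.isZmodule.Build L2 addA addC add0 addN.

Let scaleE a x : \forall t \ae mu, scale a x t = a * x t.
Proof. exact: L2classE. Qed.

Let scaleA a b x : scale a (scale b x) = scale (a * b) x.
Proof.
apply/L2_ae_eqP; apply: filterS3 (scaleE a (scale b x)) (scaleE b x)
  (scaleE (a * b) x) => t -> -> ->; exact: mulrA.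
Qed.

Let scale1 : left_id 1 scale.
Proof.
by move=> x; apply/L2_ae_eqP; apply: filterS (scaleE 1 x) => t ->; rewrite mul1r.
Qed.

Let scaleDr : right_distributive scale +%R.
Proof.
move=> a x y; apply/L2_ae_eqP.
apply: filterS3 (filterI (scaleE a x) (scaleE a y)) (addE (scale a x) (scale a y))
  (filterI (addE x y) (scaleE a (add x y))) => t [ax ay] e [xy axy].
by rewrite axy xy [RHS]e ax ay mulrDr.
Qed.

Let scaleDl x : {morph scale^~ x : a b / a + b}.
Proof.
move=> a b; apply/L2_ae_eqP.
apply: filterS3 (filterI (scaleE a x) (scaleE b x)) (scaleE (a + b) x)
  (addE (scale a x) (scale b x)) => t [ax bx] -> e.
by rewrite [RHS]e ax bx mulrDl.
Qed.

HB.instance Definition _ := GRing.Zmodule_isLmodule.Build R L2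
  scaleA scale1 scaleDr scaleDl.

Lemma L2_addE (x y : L2) : \forall t \ae mu, (x + y) t = x t + y t.
Proof. exact: addE. Qed.

Lemma L2_scaleE a (x : L2) : \forall t \ae mu, (a *: x) t = a * x t.
Proof. exact: scaleE. Qed.

Let norm (x : L2) : R := fine ('N[mu]_2%:E[EFin \o x])%E.

Let norm_class (u : Lf) : norm (L2class u) = fine ('N[mu]_2%:E[EFin \o u])%E.
Proof.
congr fine; apply: ae_eq_Lnorm2 (L2classE u).
  exact: (@measurable_funPT _ _ X (measurableTypeR R)).
exact: (@measurable_funPT _ _ X R u).
Qed.

Let ler_normD x y : norm (x + y) <= norm x + norm y.
Proof. by rewrite norm_class; exact: ler_LnormD. Qed.

Let normrZ a x : norm (a *: x) = `|a| * norm x.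
Proof.
rewrite norm_class; have /(congr1 fine) := LnormZ (L2repr x) a.
by rewrite fineM// -finite_norm_fine.
Qed.

Let normr0_eq0 x : norm x = 0 -> x = 0.
Proof.
rewrite -[x in norm x]L2reprK norm_class => /fine_Lnormr_eq0 x0.
by apply/L2_ae_eqP; apply: filterS2 x0 (L2classE 0) => t /(_ I)/= -> ->.
Qed.

HB.instance Definition _ := Lmodule_isNormed.Build R L2
  ler_normD normrZ normr0_eq0.

Lemma L2_normE (x : L2) : `|x| = fine ('N[mu]_2%:E[EFin \o x])%E.
Proof. by []. Qed.

End L2_space.

Section interval_measure.
Context (R : realType).
Implicit Types T : R.

Definition leb0T T : set (measurableTypeR R) -> \bar R :=
  mrestr (@lebesgue_measure R) (measurable_itv `]0, T[).

HB.instance Definition _ T := Measure.on (leb0T T).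

Lemma ae_leb0T T (P : R -> Prop) : (forall x, x \in `]0, T[ -> P x) ->
  \forall x \ae leb0T T, P x.
Proof.
move=> h; exists (~` [set` `]0, T[]); split => //=.
- exact: measurableC.
- by rewrite /leb0T /mrestr setICl measure0.
- by move=> x /= nPx xT; apply: nPx; apply: h.
Qed.

Lemma leb0T_fin T : (leb0T T setT < +oo)%E.
Proof.
rewrite /leb0T /mrestr setTI lebesgue_measure_itv/= lte_fin.
by case: ifP => _; rewrite ?ltry.
Qed.

Lemma bounded_Lfun T (g : R -> R) c : measurable_fun setT g ->
  (forall x, x \in `]0, T[ -> `|g x| <= c) -> g \in Lfun (leb0T T) 2%:E.
Proof.
move=> mg gc; rewrite inE; apply/andP; split; rewrite inE//= /finite_norm.
rewrite unlock /Lnorm poweR_lty//.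
have c2 : (\int[leb0T T]_x ((`|c| `^ 2)%:E) < +oo)%E.
  rewrite integral_cst//=.
  by rewrite lte_mul_pinfty// ?lee_fin ?powR_ge0//; exact: leb0T_fin.
apply: le_lt_trans c2; apply: ae_ge0_le_integral => //=.
- apply/measurable_EFinP; apply: (measurableT_comp (measurable_powR _)).
  exact: measurableT_comp.
- apply: ae_leb0T => x xT _; rewrite lee_fin ge0_ler_powR ?nnegrE//.
  by rewrite (le_trans (gc _ xT))// ler_norm.
Qed.

End interval_measure.

Notation L2 T := (LspaceType2 (leb0T T)).

Section functions_on_interval.
Context (R : realType) (T : R).
Implicit Types (u v w phi : R -> R) (m n : (R -> R) -> R).

(* Functions on (0,T) are represented by total functions R -> R of which only
   the restriction to ]0, T[ matters. *)
Definition normC v : R := sup [set `|v x| | x in `]0, T[].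

Definition C0 v :=
  [/\ {in `]0, T[, continuous v}, v x @[x --> 0^'+] --> (0 : R)
    & v x @[x --> T^'-] --> (0 : R)].

(* C_c^oo(0,T), extended by zero to R *)
Definition test_function phi :=
  [/\ forall (i : nat) (x : R), derivable (phi^`(i))%classic x 1,
      compact (closure [set x | phi x != 0])
    & closure [set x | phi x != 0] `<=` `]0, T[].

(* M(0,T), the dual of (C_0(0,T), normC): the values of m outside C0 are
   irrelevant. *)
Definition in_M m :=
  (forall a v w, C0 v -> C0 w ->
     m (fun x => a * v x + w x) = a * m v + m w) /\
  exists c, forall v, C0 v -> `|m v| <= c * normC v.

Definition normM m : R :=
  sup [set `|m v| | v in [set v | C0 v /\ normC v <= 1]].

(* an integrable w, seen as an element of M(0,T) *)
Definition L1_pairing w : (R -> R) -> R :=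
  fun v => \int[lebesgue_measure]_(x in `]0, T[) (w x * v x).

(* u \in BV(0,T) and Du = m, in the sense of distributions *)
Definition BV_with u m :=
  [/\ lebesgue_measure.-integrable `]0, T[ (EFin \o u), in_M m
    & forall phi, test_function phi -> m phi = - L1_pairing u (phi^`())%classic].

Definition BV u := exists m, BV_with u m.

Definition normL1 u : R := \int[lebesgue_measure]_(x in `]0, T[) `|u x|.

(* inf over w \in BV(0,T) of alpha |Du - w|_M + beta |Dw|_M, for u \in BV(0,T) *)
Definition TGV (alpha beta : R) u : R :=
  inf [set t | exists w m n, [/\ BV_with u m, BV_with w n &
    t = alpha * normM (fun v => m v - L1_pairing w v) + beta * normM n]].

End functions_on_interval.

Section extremal_points.
Context (R : realType) (T : R).

Definition Sfun (x y : R) : R := \1_`]x, T[ y.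

Definition Kfun (x y : R) : R :=
  if x < T / 2 then \1_`]0, x[ y * (x - y) else \1_`]x, T[ y * (y - x).

Lemma Sfun_Lfun x : Sfun x \in Lfun (leb0T T) 2%:E.
Proof.
apply: (@bounded_Lfun _ _ _ 1); first exact: measurable_indic.
by move=> y _; rewrite /Sfun indicE; case: (_ \in _); rewrite ?normr1 ?normr0.
Qed.

Lemma affine_Lfun c d : (fun x => c * x + d) \in Lfun (leb0T T) 2%:E.
Proof.
apply: (@bounded_Lfun _ _ _ (`|c| * `|T| + `|d|)).
  apply: measurable_funD => //; exact: measurable_funM.
move=> y; rewrite in_itv/= => /andP[y0 yT].
apply: le_trans (ler_normD _ _) _; rewrite lerD2r normrM ler_wpM2l//.
by rewrite !gtr0_norm ?ltW// (lt_trans y0).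
Qed.

Lemma Kfun_Lfun x : Kfun x \in Lfun (leb0T T) 2%:E.
Proof.
have mId := @measurable_id _ _ [set: measurableTypeR R].
apply: (@bounded_Lfun _ _ _ (`|x| + `|T|)).
  rewrite /Kfun; case: (x < T / 2); apply: measurable_funM;
    by [exact: measurable_indic | exact: measurable_funB].
move=> y; rewrite in_itv/= => /andP[y0 yT].
have yT' : `|y| <= `|T| by rewrite !gtr0_norm ?ltW// (lt_trans y0).
have xy : `|x - y| <= `|x| + `|T|.
  by apply: le_trans (ler_normB _ _) _; rewrite lerD2l.
by rewrite /Kfun; case: ifP => _; rewrite normrM indicE 1?(distrC y);
  case: (_ \in _); rewrite ?normr1 ?normr0 ?mul1r ?mul0r// addr_ge0.
Qed.

(* the classes in L^2(0,T) of S_x, K_x and of affine functions *)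
Definition SL2 x : L2 T := L2class (Lfun_Sub (lee1n 2) (Sfun_Lfun x)).

Definition KL2 x : L2 T := L2class (Lfun_Sub (lee1n 2) (Kfun_Lfun x)).

Definition affine : set (L2 T) :=
  [set l | exists c d, l = L2class (Lfun_Sub (lee1n 2) (affine_Lfun c d))].

Definition ExtB (alpha beta : R) : set (L2 T) :=
  [set v | (exists2 x, x \in `]0, T[ &
              v = alpha^-1 *: SL2 x \/ v = - (alpha^-1 *: SL2 x)) \/
           (exists2 x, x \in `](beta / alpha), (T - beta / alpha)[ &
              v = beta^-1 *: KL2 x \/ v = - (beta^-1 *: KL2 x))].

End extremal_points.

Section algorithm.
Context (R : realType) (T alpha beta : R).
Implicit Types (f : L2 T -> R) (g : L2 T) (A : {fset L2 T}) (lam : L2 T -> R).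

Definition dot (g h : L2 T) : R := \int[leb0T T]_x (g x * h x).

(* f is Frechet differentiable and grad u is the Riesz representative of its
   derivative at u *)
Definition is_gradient f (grad : L2 T -> L2 T) :=
  forall u, differentiable f u /\ forall h, 'd f u h = dot (grad u) h.

(* the first and second primitives p and P of the gradient g, P with a sign *)
Definition prim1 g (x : R) : R := \int[lebesgue_measure]_(s in `[0, x]) g s.

Definition prim2 g (x : R) : R :=
  - \int[lebesgue_measure]_(s in `[0, x]) prim1 g s.

(* The finite-dimensional problem on the active set A.  Weights are indexed by
   the elements of A, so A needs no ordering; lam v is irrelevant for
   v \notin A. *)
Definition combination A lam (l : L2 T) : L2 T := \sum_(v <- A) lam v *: v + l.

Definition weight A lam : R := \sum_(v <- A) lam v.

Definition minimizer f A lam l :=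
  [/\ forall v, v \in A -> 0 <= lam v, affine l
    & forall lam' l', (forall v, v \in A -> 0 <= lam' v) -> affine l' ->
        f (combination A lam l) + weight A lam <=
        f (combination A lam' l') + weight A lam'].

(* A solution of the problem on A: its function u, and A' obtained from A by removing the
   elements with zero weight *)
Definition solve_prune f A lam l u A' :=
  [/\ minimizer f A lam l, u = combination A lam l
    & A' = [fset v in A | lam v != 0]%fset].

Definition new_point g (xS xK : R) : L2 T :=
  if normC T (prim2 g) / beta <= normC T (prim1 g) / alpha
  then (Num.sg (prim1 g xS) / alpha) *: SL2 T xS
  else (Num.sg (prim2 g xK) / beta) *: KL2 T xK.

(* A run that does not terminate: A k, lam k, l k, u k are the active set, the
   weights, the affine part and the function of the k-th iterate, k >= 1 (with
   A 0 the input), and uhat k is the point inserted at iteration k. *)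
Record infinite_run f (grad : L2 T -> L2 T) (A : nat -> {fset L2 T})
    (lam : nat -> L2 T -> R) (l u uhat : nat -> L2 T) (xS xK : nat -> R)
    : Prop := {
  run_input : forall v, v \in A 0%N -> ExtB alpha beta v ;
  run_first : solve_prune f (A 0%N) (lam 1%N) (l 1%N) (u 1%N) (A 1%N) ;
  run_xS : forall k, (0 < k)%N -> (xS k \in `]0, T[) /\
    `|prim1 (grad (u k)) (xS k)| = normC T (prim1 (grad (u k))) ;
  run_xK : forall k, (0 < k)%N -> (xK k \in `]0, T[) /\
    `|prim2 (grad (u k)) (xK k)| = normC T (prim2 (grad (u k))) ;
  run_continues : forall k, (0 < k)%N ->
    ~ (normC T (prim1 (grad (u k))) <= alpha /\
       normC T (prim2 (grad (u k))) <= beta) ;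
  run_new_point : forall k, (0 < k)%N ->
    uhat k = new_point (grad (u k)) (xS k) (xK k) ;
  run_step : forall k, (0 < k)%N ->
    solve_prune f (uhat k |` A k)%fset (lam k.+1) (l k.+1) (u k.+1) (A k.+1)
}.

(* Since BV(0,T) is contained in L^2(0,T), the elements of BV(0,T) are the
   u : L2 T with BV T u. *)
Definition J f (u : L2 T) : R := f u + TGV T alpha beta u.

Definition sublevel_sets_bounded f :=
  forall c, exists b, forall (u : L2 T) m, BV_with T u m ->
    J f u <= c -> normL1 T u + normM T m <= b.

Definition minJ f : R := inf [set J f u | u in [set u : L2 T | BV T u]].

Definition residual f (u : L2 T) A lam : R := f u + weight A lam - minJ f.

(* Psi(u_k), for g the gradient at u_k *)
Definition violation (M0 : R) g : R :=
  M0 * (Num.max (normC T (prim1 g) / alpha) (normC T (prim2 g) / beta) - 1).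

End algorithm.

(* min_(1 <= j <= k) F j, for 1 <= k *)
Definition min_upto (R : realType) (F : nat -> R) (k : nat) : R :=
  \big[Num.min/F 1%N]_(1 <= j < k.+1) F j.

(* Main.v *)
Require Import Defs.
From HB Require Import structures.
From mathcomp Require Import all_boot all_order all_algebra finmap.
From mathcomp Require Import all_classical all_reals all_analysis measurable_realfun.
From mathcomp Require Import ring lra.

(* Inserting [t * M0] times the new point [uhat k], without touching the other
   weights, is admissible for every [t >= 0]; since the first-order conditions
   give [dot (grad (u k)) (uhat k) = - m_k], with [m_k] the maximum in the
   definition of Psi, the descent lemma shows that each step decreases the
   residual by at least [Psi_k ^ 2 / (2 Lf C ^ 2)].  Summing, [min Psi] is at most
   half of the right-hand side.  For the other half, the gap between the weight
   and TGV is at most Psi: writing g for the gradient at [u k], p and P for its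
   primitives [prim1 g] and [prim2 g], the optimality conditions give
   [weight = - dot g (u k)], and [P / m_k] is admissible in the dual formulation
   of TGV, so that [weight <= m_k * TGV]; moreover [TGV <= weight <= M0].
   The duality argument pairs distributional derivatives with P and p, which
   are not test functions: this needs the density of test functions in
   [C0(0,T)]. *)

Set Implicit Arguments.
Unset Strict Implicit.
Unset Printing Implicit Defensive.

Import Order.TTheory GRing.Theory Num.Theory.
Import numFieldNormedType.Exports.

Local Open Scope classical_set_scope.
Local Open Scope ring_scope.

(** * Smooth functions with compact support *)

Section smooth_functions.
Context {R : realType}.
Implicit Types (f g : R -> R) (x : R).

(** The step [t] of the descent estimate is not confined to [0, 1]: the old weights are kept instead
    of being contracted towards the new point, and the finite-dimensional problem only asks for
    nonnegative weights. The quadratic bound can therefore be minimized over all [t >= 0], and no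
    separate case of short steps arises. In the duality part, the competitors of TGV are abstract
    functionals tied to functions only through test functions. Stationarity in the affine directions
    makes p and P vanish at T, so that both belong to C0(0,T) and such functionals can be evaluated
    on them. Two facts then follow from density: a distributional derivative is determined on C0,
    which allows an arbitrary competitor to be compared with an explicit one, and integration by
    parts extends to P, in the form n(P) = int w p for n = Dw. Upper bounds on TGV are carried as
    explicit competitors ([TGV_cert]): these combine linearly, as the iterate does, and retain the
    value of Du at p, which is what links the gradient with TGV. *)

Definition smooth f := forall (i : nat) x, derivable (f^`(i))%classic x 1.

(** Coinduction principle: [smooth] is the largest class of differentiable functions stable under
    derivation, so a closure property reduces to exhibiting one stable class that contains the
    function. *)
Lemma smooth_coind (P : (R -> R) -> Prop) :
  (forall f, P f -> (forall x, derivable f x 1) /\ P (f^`())%classic) ->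
  forall f, P f -> smooth f.
Proof.
move=> PP f Pf i; have Pi : P (f^`(i))%classic.
  elim: i => [|i Pi]; first by rewrite derive1n0.
  by rewrite derive1nS; case: (PP _ Pi).
by case: (PP _ Pi).
Qed.

Lemma smooth_derivable f x : smooth f -> derivable f x 1.
Proof. by move=> /(_ 0%N); rewrite derive1n0. Qed.

Lemma smooth_derive1 f : smooth f -> smooth (f^`())%classic.
Proof. by move=> sf i x; rewrite -derive1Sn; exact: sf. Qed.

Lemma derive1_ext f df : (forall x, is_derive x 1 f (df x)) ->
  (f^`())%classic = df.
Proof. by move=> h; apply/funext => x; rewrite derive1E; exact: derive_val. Qed.

Lemma is_derive_derive1 f x : derivable f x 1 ->
  is_derive x 1 f ((f^`())%classic x).
Proof. by move=> /derivableP; rewrite -derive1E. Qed.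

Lemma smooth_primitive f g : (forall x, is_derive x 1 f (g x)) -> smooth g ->
  smooth f.
Proof.
move=> fg sg [|i] x; first by rewrite derive1n0; apply: ex_derive.
by rewrite derive1Sn (derive1_ext fg); exact: sg.
Qed.

Lemma smooth_cst (c : R) : smooth (cst c).
Proof.
apply: (smooth_coind (P := fun h => exists c, h = cst c)); last by exists c.
move=> _ [{}c ->]; split=> [x|]; first exact: derivable_cst.
by exists 0; apply: derive1_ext => x.
Qed.

Lemma smoothD f g : smooth f -> smooth g -> smooth (f + g).
Proof.
move=> sf sg.
apply: (smooth_coind (P := fun h =>
  exists f g, [/\ smooth f, smooth g & h = f + g])); last by exists f, g.
move=> _ [{sf}f [{sg}g [sf sg ->]]].
have fgE x : is_derive x 1 (f + g) ((f^`())%classic x + (g^`())%classic x).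
  by apply: is_deriveD; apply: is_derive_derive1; exact: smooth_derivable.
split=> [x|]; first exact: ex_derive.
by exists (f^`())%classic, (g^`())%classic; split;
  [exact: smooth_derive1..|exact: derive1_ext].
Qed.

(** A single product is not stable under derivation, but finite sums of products are; [D] expands
    one product by the Leibniz rule. *)
Lemma smoothM f g : smooth f -> smooth g -> smooth (f * g).
Proof.
move=> sf sg.
apply: (smooth_coind (P := fun h => exists s : seq ((R -> R) * (R -> R)),
  (forall p, p \in s -> smooth p.1 /\ smooth p.2) /\
  h = fun x => \sum_(p <- s) p.1 x * p.2 x)); last first.
  exists [:: (f, g)]; split=> [p|].
    by rewrite inE => /eqP ->; exact: (conj sf sg).
  by apply/funext => x; rewrite big_seq1.
move=> _ [s [ss ->]].
pose D (p : (R -> R) * (R -> R)) :=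
  [:: ((p.1^`())%classic, p.2); (p.1, (p.2^`())%classic)].
have DE x : is_derive x 1 (fun x => \sum_(p <- s) p.1 x * p.2 x)
    (\sum_(p <- flatten (map D s)) p.1 x * p.2 x).
  elim: s ss => [|p s IH] ss.
    under [X in is_derive _ _ X]eq_fun do rewrite big_nil.
    by rewrite big_nil; exact: is_derive_cst.
  under [X in is_derive _ _ X]eq_fun do rewrite big_cons.
  rewrite /= !big_cons addrA; apply: is_deriveD; last first.
    by apply: IH => q qs; apply: ss; rewrite in_cons qs orbT.
  have [s1 s2] := ss p (mem_head _ _).
  have := is_deriveM (is_derive_derive1 (smooth_derivable s1 (x := x)))
                     (is_derive_derive1 (smooth_derivable s2 (x := x))).
  move=> h; apply: (is_derive_eq h); rewrite /GRing.scale/=; ring.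
split=> [x|]; first exact: ex_derive.
exists (flatten (map D s)); split; last exact: derive1_ext.
move=> q /flattenP[_ /mapP[p ps ->]].
have [s1 s2] := ss _ ps.
rewrite !inE => /orP[]/eqP ->; split.
- exact: smooth_derive1 s1.
- exact: s2.
- exact: s1.
- exact: smooth_derive1 s2.
Qed.

Lemma smooth_affine f (a b : R) : smooth f -> smooth (fun x => f (a * x + b)).
Proof.
move=> sf.
apply: (smooth_coind (P := fun h => exists f c, smooth f /\
  h = fun x => c * f (a * x + b))); last first.
  by exists f, 1; split => //; apply/funext => x; rewrite mul1r.
move=> _ [{sf}f [c [sf ->]]].
have fE x : is_derive x 1 (fun x => c * f (a * x + b))
    ((c * a) * (f^`())%classic (a * x + b)).
  have h1 : is_derive x (1 : R) (fun x => a * x + b) a.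
    have := is_deriveD (is_deriveZ a (is_derive_id x (1 : R))) (is_derive_cst b x (1:R)).
    by rewrite addr0 /GRing.scale/= mulr1.
  have h2 := @is_derive1_comp _ f (fun x => a * x + b) x _ _
     (is_derive_derive1 (smooth_derivable sf (x := a * x + b))) h1.
  have h3 := is_deriveZ c h2.
  apply: (is_derive_eq h3); rewrite /GRing.scale/=; ring.
split=> [x|]; first exact: ex_derive.
exists (f^`())%classic, (c * a); split; first exact: smooth_derive1.
exact: derive1_ext.
Qed.

Lemma smoothZ (c : R) f : smooth f -> smooth (fun x => c * f x).
Proof. by move=> /(smoothM (@smooth_cst c)). Qed.

Lemma smooth_sum (I : Type) (s : seq I) (F : I -> R -> R) :
  (forall i, smooth (F i)) -> smooth (fun x => \sum_(i <- s) F i x).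
Proof.
move=> sF; elim: s => [|i s IH].
  rewrite (_ : (fun _ => _) = cst 0); last first.
    by apply/funext => x; rewrite big_nil.
  exact: smooth_cst.
rewrite (_ : (fun _ => _) = F i + (fun x => \sum_(j <- s) F j x)); last first.
  by apply/funext => x; rewrite big_cons.
exact: smoothD (sF i) IH.
Qed.

Lemma smooth_continuous f : smooth f -> continuous f.
Proof.
move=> sf x; apply: differentiable_continuous; apply/derivable1_diffP.
exact: smooth_derivable.
Qed.

(** Serves at the point 0 where the two branches of [flat] meet; the hypothesis at [h = 0] forces
    [f 0 = 0]. *)
Lemma is_derive0_quadratic f (c : R) :
  (forall h, `|h| <= 1 -> `|f h| <= c * h ^+ 2) -> is_derive (0 : R) 1 f 0.
Proof.
move=> fc.
have f0 : f 0 = 0.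
  by apply/eqP; rewrite -normr_le0; have := fc 0; rewrite normr0 expr0n/= mulr0; apply.
have c0 : 0 <= c.
  by have := fc 1; rewrite normr1 lexx expr1n mulr1 => /(_ isT); apply: le_trans.
have cvg0 : h^-1 *: ((f \o shift 0) (h *: (1 : R)) - f 0) @[h --> (0:R)^'] --> (0:R).
  apply/cvgr0Pnorm_le => e e0.
  have d0 : 0 < Num.min 1 (e / (c + 1)).
    by rewrite lt_min ltr01/= divr_gt0// ltr_pwDr.
  near=> h.
  have h0 : h != 0 by near: h; exact: nbhs_dnbhs_neq.
  have : `|h| <= Num.min 1 (e / (c + 1)).
    by near: h; exact: dnbhs0_le.
  rewrite le_min => /andP[h1 he].
  rewrite /= f0 subr0 addr0 /GRing.scale/= mulr1 normrM normfV.
  rewrite ler_pdivrMl ?normr_gt0//; apply: le_trans (fc _ h1) _.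
  rewrite -real_normK ?num_real// expr2 [leRHS]mulrC mulrA ler_wpM2r//.
  apply: le_trans (_ : (c + 1) * `|h| <= _).
    by rewrite ler_wpM2r// lerDl.
  by rewrite -ler_pdivlMl ?ltr_pwDr// mulrC.
apply: DeriveDef; last by apply: cvg_lim cvg0.
by apply/cvg_ex; exists 0.
Unshelve. all: by end_near. Qed.

(** The classical exp(-1/x) glued with zero. The polynomial factor in 1/x makes the family stable
    under derivation. *)
Let flat (q : {poly R}) x : R :=
  if 0 < x then q.[x^-1] * expR (- x^-1) else 0.

Let flat_quadratic (q : {poly R}) :
  exists c, forall h, `|h| <= 1 -> `|flat q h| <= c * h ^+ 2.
Proof.
(* On ]0, 1] the polynomial is at most [S] times h to the power - [size q], and exp(-1/h) is at most
   n! h^n; two extra powers leave h^2. *)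
pose n := (size q).+2; pose S := \sum_(i < size q) `|q`_i|.
have S0 : 0 <= S by apply: sumr_ge0.
exists (S * n`!%:R) => h h1; rewrite /flat; case: ifPn => [h0|_]; last first.
  by rewrite normr0 mulr_ge0 ?sqr_ge0// mulr_ge0.
have hn1 : 1 <= h^-1 by rewrite invf_ge1// -(gtr0_norm h0).
have q1 : `|q.[h^-1]| <= S * h^-1 ^+ size q.
  rewrite horner_coef mulr_suml; apply: le_trans (ler_norm_sum _ _ _) _.
  apply: ler_sum => i _; rewrite normrM ler_wpM2l// normrX.
  rewrite (@gtr0_norm _ h^-1) ?invr_gt0//; apply: ler_weXn2l => //.
  exact: ltnW.
have e1 : expR (- h^-1) <= n`!%:R * h ^+ n.
  rewrite expRN -[leRHS]invrK lef_pV2 ?posrE ?expR_gt0//; last first.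
    by rewrite invr_gt0 mulr_gt0 ?exprn_gt0// ltr0n fact_gt0.
  have := @expR_ge1Dxn R h^-1 (size q).+1 (le_trans ler01 hn1).
  by apply: le_trans; rewrite invfM mulrC -exprVn lerDr.
rewrite normrM (gtr0_norm (expR_gt0 _)).
apply: le_trans (ler_pM (normr_ge0 _) (expR_ge0 _) q1 e1) _.
rewrite le_eqVlt; apply/orP; left; apply/eqP.
rewrite /n -[(size q).+2]addn2 exprD exprVn.
have hs : h ^+ size q != 0 by rewrite expf_neq0// gt_eqF.
by field.
Qed.

Lemma smooth_flat (q : {poly R}) : smooth (flat q).
Proof.
apply: (smooth_coind (P := fun h => exists q, h = flat q)); last by exists q.
move=> _ [{}q ->].
(* The derivative of q(1/x) exp(-1/x) is x^-2 (q - q')(1/x) exp(-1/x). *)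
pose dq := 'X ^+ 2 * (q - deriv q).
have fE x : is_derive x (1 : R) (flat q) (flat dq x).
  have [x0|x0|x0] := ltgtP 0 x.
  - have xV : is_derive x (1 : R) (fun x : R => x^-1) (- x^-2).
      have := is_deriveV (f := id) (lt0r_neq0 x0) (is_derive_id x 1).
      by rewrite /GRing.scale/= mulr1.
    have h1 := is_derive1_comp (is_derive_poly q x^-1) xV.
    have xNV : is_derive x (1 : R) (fun x : R => - x^-1) (x^-2).
      by have := is_deriveN xV; rewrite opprK.
    have h2 := @is_derive1_comp _ expR (fun y : R => - y^-1) x _ _
      (is_derive_expR (- x^-1)) xNV.
    have h3 := is_deriveM h1 h2.
    apply: (@near_eq_is_derive _ _ _ ((horner q \o (fun x : R => x^-1)) *
       (expR \o (fun x : R => - x^-1)))) => //.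
    + by near=> y; rewrite /flat ifT//; near: y; exact: lt_nbhsr.
    + apply: is_derive_eq h3 _.
      rewrite /flat x0 /dq /GRing.scale/= hornerM hornerXn hornerD hornerN /=.
      rewrite -exprVn; ring.
  - have e0 : flat dq x = 0 by rewrite /flat ltNge ltW.
    rewrite e0; apply: (@near_eq_is_derive _ _ _ (cst 0)) => //.
    near=> y; rewrite /flat ifF//; apply/negbTE; rewrite -leNgt ltW//.
    by near: y; exact: lt_nbhsl.
  - have [c hc] := flat_quadratic q.
    rewrite -x0 {2}/flat ltxx; exact: is_derive0_quadratic hc.
split=> [x|]; first exact: ex_derive.
by exists dq; exact: derive1_ext.
Unshelve. all: by end_near. Qed.

Definition flat_bump x := flat 1 x * flat 1 (1 - x).

Lemma smooth_flat_bump : smooth flat_bump.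
Proof.
have -> : flat_bump = flat 1 * (fun x => flat 1 (-1 * x + 1)).
  by apply/funext => x; rewrite fctE /flat_bump mulN1r addrC.
by apply: smoothM; [|apply: smooth_affine]; exact: smooth_flat.
Qed.

Lemma flat_bump_gt0 x : 0 < x < 1 -> 0 < flat_bump x.
Proof.
move=> /andP[x0 x1].
by rewrite /flat_bump /flat x0 subr_gt0 x1 !hornerC !mul1r mulr_gt0// expR_gt0.
Qed.

Lemma flat_bump_eq0 x : x \notin `[0, 1] -> flat_bump x = 0.
Proof.
rewrite in_itv/= negb_and -!ltNge /flat_bump /flat => /orP[x0|x1].
  by rewrite ltNge ltW// mul0r.
by rewrite subr_gt0 [x < 1]ltNge ltW// mulr0.
Qed.

Lemma flat_bump_ge0 x : 0 <= flat_bump x.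
Proof.
by rewrite /flat_bump /flat; case: ifP; case: ifP => _ _;
  rewrite ?mul0r ?mulr0// !hornerC !mul1r mulr_ge0// expR_ge0.
Qed.

End smooth_functions.

(** * Density of test functions in C0(0,T) *)

Section density.
Context {R : realType}.
Implicit Types (f g v : R -> R) (x : R).
Local Notation mu := (@lebesgue_measure R).

(** Compactness in near-covering form yields one [d] for all [x]. Only [x] is confined to [a, b],
    which spares a membership check for [y] in applications. *)
Lemma itv_unif_continuous v (a b e : R) : continuous v -> 0 < e ->
  exists2 d, 0 < d & forall x y, x \in `[a, b] -> `|x - y| < d ->
    `|v x - v y| <= e.
Proof.
move=> cv e0.
have /compact_near_coveringP/(_ R (0:R)^'+
    (fun d x => forall y, `|x - y| < d -> `|v x - v y| <= e)) := @segment_compact _ a b.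
have H x : `[a, b]%classic x -> \forall x' \near x & i \near 0^'+,
    (fun d x => forall y, `|x - y| < d -> `|v x - v y| <= e) i x'.
  move=> _; have /cvgrPdist_le/(_ (e / 2)) := cv x.
  rewrite divr_gt0// => /(_ isT)/nbhs_ballP[r /= r0 hr].
  near=> x' d => y /= xy.
  have x'r : `|x - x'| < r / 2.
    by near: x'; apply: (nbhsx_ballx x (r / 2)); rewrite divr_gt0.
  have dr : d < r / 2.
    by near: d; apply: nbhs_right_lt; rewrite divr_gt0.
  have h1 : `|v x - v x'| <= e / 2.
    by apply: hr; rewrite -ball_normE /=; apply: lt_le_trans x'r _; lra.
  have h2 : `|v x - v y| <= e / 2.
    apply: hr; rewrite -ball_normE /= -(subrKA x').
    by apply: le_lt_trans (ler_normD _ _) _; lra.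
  rewrite -(subrKA (v x)); apply: le_trans (ler_normD _ _) _.
  by rewrite (distrC (v x')); lra.
move=> /(_ _ H) near0.
near (0:R)^'+ => d; exists d; first by near: d; exact: nbhs_right_gt.
move=> x y xab; have : `[a, b]%classic `<=`
    (fun x => forall y : R, `|x - y| < d -> `|v x - v y| <= e).
  near: d; exact: near0.
exact.
Unshelve. all: by end_near. Qed.

Lemma supported_integrable f (a b : R) : continuous f ->
  (forall x, x \notin `[a, b] -> f x = 0) ->
  mu.-integrable setT (EFin \o f).
Proof.
move=> cf f0.
have -> : EFin \o f = (EFin \o f) \_ `[a, b].
  apply/funext => x; rewrite patchE mem_setE; case: ifPn => // /f0 /= ->.
  by [].
apply: (integrable_mkcond _ _).1 => //; apply: continuous_compact_integrable.
  exact: segment_compact.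
exact: continuous_subspaceT.
Qed.

(** Starting at -oo makes the primitive of a function supported in [a, b] vanish to the left of a
    and stay constant to the right of b. *)
Definition primitive f x := \int[mu]_(t in `]-oo, x]) f t.

Section primitive.
Variables (f : R -> R) (a b : R).
Hypotheses (sf : smooth f) (f0 : forall x, x \notin `[a, b] -> f x = 0).

Let cf : continuous f. Proof. exact: smooth_continuous. Qed.

Lemma is_derive_primitive x : is_derive x (1 : R) (primitive f) (f x).
Proof.
have xx1 : x < x + 1 by rewrite ltrDl.
have fi : mu.-integrable [set` Interval -oo%O (BRight (x + 1))] (EFin \o f).
  by apply: integrableS (supported_integrable cf f0).
have cfx : {for x, continuous f} by exact: cf.
have [|d1 d2] := continuous_FTC1 xx1 fi _ cfx; first exact: ltNyr.
rewrite -d2; exact: is_derive_derive1.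
Qed.

Lemma smooth_primitive_supported : smooth (primitive f).
Proof. exact: smooth_primitive is_derive_primitive sf. Qed.

Lemma primitive_eq0 x : x < a -> primitive f x = 0.
Proof.
move=> xa; rewrite /primitive (@eq_Rintegral _ _ _ _ _ (cst 0)).
  by rewrite Rintegral_cst// mul0r.
move=> y; rewrite inE/= in_itv/= => yx; rewrite f0// in_itv/= negb_and -ltNge.
by rewrite (le_lt_trans yx).
Qed.

Lemma primitive_total x : b <= x -> primitive f x = \int[mu]_(t in `[a, b]) f t.
Proof.
move=> bx; rewrite /primitive Rintegral_mkcond [RHS]Rintegral_mkcond.
congr (Rintegral _ _ _); apply/funext => y; rewrite !patchE !mem_setE.
have [yab|/f0 ->] := boolP (y \in `[a, b]); last by rewrite if_same.
rewrite ifT//; move: yab; rewrite !in_itv/= => /andP[_ yb].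
exact: le_trans yb bx.
Qed.

End primitive.

Let flat_bump0 := @flat_bump_eq0 R.
Let dbump x : is_derive x (1 : R) (primitive flat_bump) (flat_bump x) :=
  is_derive_primitive (@smooth_flat_bump R) flat_bump0 x.

Let cbump : continuous (primitive (@flat_bump R)).
Proof. exact: smooth_continuous (smooth_primitive_supported (@smooth_flat_bump R) flat_bump0). Qed.

Let bump1_gt0 : 0 < primitive (@flat_bump R) 1.
Proof.
have [c c01] := @MVT _ (primitive flat_bump) flat_bump 0 1 ltr01
  (fun x _ => dbump x) (continuous_subspaceT cbump).
rewrite subr0 mulr1 => /eqP; rewrite subr_eq => /eqP ->.
apply: ltr_wpDr; last by apply: flat_bump_gt0; move: c01; rewrite in_itv.
by apply: Rintegral_ge0 => x _; exact: flat_bump_ge0.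
Qed.

(** A smooth Heaviside function, rising from 0 to 1 across [0, 1]; differences of its translates
    telescope, which gives partitions of unity. *)
Definition step x := primitive flat_bump x / primitive flat_bump 1.

Lemma is_derive_step x :
  is_derive x (1 : R) step ((primitive flat_bump 1)^-1 * flat_bump x).
Proof.
rewrite /step (_ : (fun _ => _) = (primitive flat_bump 1)^-1 *: (primitive (@flat_bump R))).
  by apply: (is_derive_eq (is_deriveZ _ (dbump x))).
by apply/funext => y; rewrite mulrC.
Qed.

Lemma smooth_step : smooth step.
Proof.
by apply: (smooth_primitive is_derive_step); apply: smoothZ; exact: smooth_flat_bump.
Qed.

Lemma step_eq0 x : x <= 0 -> step x = 0.
Proof.
rewrite le_eqVlt => /predU1P[->|x0]; last first.
  by rewrite /step (primitive_eq0 flat_bump0)// mul0r.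
rewrite /step; have -> : primitive flat_bump (0 : R) = 0; last by rewrite mul0r.
rewrite /primitive (@eq_Rintegral _ _ _ _ _ (cst 0)).
  by rewrite Rintegral_cst// mul0r.
by move=> y; rewrite inE/= in_itv/= => y0; rewrite /flat_bump ltNge y0 mul0r.
Qed.

Lemma step_eq1 x : 1 <= x -> step x = 1.
Proof.
move=> x1; rewrite /step (primitive_total flat_bump0)// -(primitive_total flat_bump0 (lexx 1)).
by rewrite divff// gt_eqF.
Qed.

Lemma step_ndecr x y : x <= y -> step x <= step y.
Proof.
move=> xy; apply: (@ger0_derive1_ndecr _ step x y) => //.
- by move=> z _; exact: smooth_derivable smooth_step.
- move=> z _; rewrite (derive1_ext is_derive_step).
  by rewrite mulr_ge0 ?flat_bump_ge0// invr_ge0 ltW.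
- by apply: continuous_subspaceT; exact: smooth_continuous smooth_step.
Qed.

Lemma test_function_supported (T a b : R) f : smooth f -> 0 < a -> b < T ->
  (forall x, x \notin `[a, b] -> f x = 0) -> test_function T f.
Proof.
move=> sf a0 bT f0.
have sub : closure [set x | f x != 0] `<=` `[a, b].
  apply: (subset_trans (closureS (B := `[a, b]%classic) _)).
    move=> x /= fx; apply/negPn/negP => /f0 fx0; move: fx; rewrite fx0 eqxx//.
  by rewrite -(closure_id _).1//; exact: itv_closed.
split => //.
  apply: subclosed_compact (@closed_closure _ _) (@segment_compact _ a b) sub.
move=> x /sub; rewrite /= !in_itv/= => /andP[ax xb].
by rewrite (lt_le_trans a0)//= (le_lt_trans xb).
Qed.

(** The one-sided limits in [C0] amount to continuity at 0 and T of the extension by zero.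
    Compactness of [0, T] then becomes available for elements of [C0]. *)
Lemma C0_patch_continuous (T : R) v : 0 < T -> C0 T v -> continuous (v \_ `]0, T[).
Proof.
move=> T0 [cv v0 vT] x.
have out y : y \notin `]0, T[ -> (v \_ `]0, T[) y = 0.
  by rewrite patchE mem_setE => /negbTE ->.
have inn y : y \in `]0, T[ -> (v \_ `]0, T[) y = v y.
  by rewrite patchE mem_setE => ->.
have [x0|x0|x0] := ltgtP x 0.
- rewrite /prop_for /continuous_at out; last by rewrite in_itv/= ltNge ltW.
  apply: cvg_near_cst; near=> y.
  by rewrite out// in_itv/= ltNge ltW//=; near: y; exact: lt_nbhsl.
- have [xT|xT|xT] := ltgtP x T.
  + have xoo : x \in `]0, T[ by rewrite in_itv/= x0.
    rewrite /prop_for /continuous_at inn//.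
    apply: cvg_trans (cv _ xoo); apply: near_eq_cvg; near=> y.
    rewrite inn// in_itv/=; apply/andP; split; near: y;
      [exact: lt_nbhsr|exact: lt_nbhsl].
  + rewrite /prop_for /continuous_at out; last by rewrite in_itv/= [x < T]ltNge ltW// andbF.
    apply: cvg_near_cst; near=> y.
    by rewrite out// in_itv/= [y < T]ltNge ltW ?andbF//; near: y; exact: lt_nbhsr.
  + apply/left_right_continuousP.
    rewrite out; last by rewrite xT in_itv/= ltxx andbF.
    split.
      rewrite xT; apply: cvg_trans vT; apply: near_eq_cvg; near=> y.
      rewrite inn// in_itv/=; apply/andP; split; near: y.
        exact: nbhs_left_gt.
      exact: nbhs_left_lt.
    apply: cvg_near_cst; near=> y.
    rewrite out// in_itv/= [y < T]ltNge ltW ?andbF//.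
    by near: y; rewrite xT; exact: nbhs_right_gt.
- apply/left_right_continuousP.
  rewrite out; last by rewrite x0 in_itv/= ltxx.
  split.
    apply: cvg_near_cst; near=> y.
    rewrite out// in_itv/= ltNge ltW//.
    by near: y; rewrite x0; exact: nbhs_left_lt.
  rewrite x0; apply: cvg_trans v0; apply: near_eq_cvg; near=> y.
  rewrite inn// in_itv/=; apply/andP; split; near: y.
    exact: nbhs_right_gt.
  exact: nbhs_right_lt.
Unshelve. all: by end_near. Qed.

(* The approximant is [\sum_i c i * hat i], where the hat functions
   [step (s - i + 1) - step (s - i)], [s = x / h], form a smooth partition of
   unity on [0, T] subordinate to the grid of mesh [h = T / N], and [c i] is the
   value of [v] at the node [i * h], replaced by 0 at the outermost nodes. *)
Lemma C0_smooth_approx (T : R) v (e : R) : 0 < T -> C0 T v -> 0 < e ->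
  exists f a b, [/\ smooth f, 0 < a, a < b, b < T &
    (forall x, x \notin `[a, b] -> f x = 0) /\
    (forall x, x \in `]0, T[ -> `|v x - f x| <= e)].
Proof.
move=> T0 Cv e0; pose w := v \_ `]0, T[.
have cw : continuous w := C0_patch_continuous T0 Cv.
have w0 x : x \notin `]0, T[ -> w x = 0.
  by rewrite /w patchE mem_setE => /negbTE ->.
have [d d0 hd] := itv_unif_continuous 0 T cw e0.
(* The bound makes 2h smaller than the modulus [d]: a point within h of an outermost node, where the
   coefficient is 0, is within 2h of an endpoint, where [w] vanishes. The shift by 3 ensures h < T -
   h. *)
pose N := (Num.bound (2 * T / d)).+3; pose h := T / N%:R.
have N0 : 0 < N%:R :> R by rewrite ltr0n.
have N3 : 3 <= N%:R :> R by rewrite ler_nat.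
have h0 : 0 < h by rewrite divr_gt0.
have hN : h * N%:R = T by rewrite /h divfK// gt_eqF.
have h2d : 2 * h < d.
  rewrite /h mulrA ltr_pdivrMr// -ltr_pdivrMl// [ltLHS]mulrC.
  have b0 : 0 <= 2 * T / d by rewrite divr_ge0// ?mulr_ge0// ltW.
  apply: lt_trans (archi_boundP b0) _.
  by rewrite ltr_nat /N -addn3 -[X in (X < _)%N]addn0 ltn_add2l.
pose c (i : nat) := if (2 <= i <= N.-2)%N then w (i%:R * h) else 0.
pose hat (i : nat) x := step (h^-1 * x + (1 - i%:R)) - step (h^-1 * x + (- i%:R)).
have shat i : smooth (hat i).
  apply: smoothD; first by apply: smooth_affine; exact: smooth_step.
  rewrite (_ : (fun _ => _) = fun x => -1 * step (h^-1 * x + (- i%:R))).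
    by apply: smoothZ; apply: smooth_affine; exact: smooth_step.
  by apply/funext => x; rewrite mulN1r.
have hat_ge0 i x : 0 <= hat i x.
  by rewrite subr_ge0; apply: step_ndecr; rewrite lerD2l; lra.
have hat_eq0 i x : h <= `|x - i%:R * h| -> hat i x = 0.
  rewrite /hat ler_normr => /orP[] hx.
    have hx' : 1 <= h^-1 * x - i%:R.
      by rewrite lerBrDr ler_pdivlMl//; lra.
    by rewrite !step_eq1 ?subrr//; lra.
  have hx' : h^-1 * x - i%:R <= -1.
    by rewrite lerBlDr ler_pdivrMl//; lra.
  by rewrite !step_eq0 ?subrr//; lra.
have hat1 x : x \in `]0, T[ -> \sum_(0 <= i < N.+1) hat i x = 1.
  rewrite in_itv/= => /andP[x0 xT].
  (* With s = x / h, the sum telescopes to step(s + 1) - step(s - N), that is 1 - 0 for x in ]0,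
     T[. *)
  pose F i := - step (h^-1 * x + (1 - i%:R)).
  rewrite (eq_big_nat _ _ (F2 := fun i => F i.+1 - F i)); last first.
    move=> i _; rewrite /F /hat opprK [RHS]addrC -natr1.
    by have -> : 1 - (i%:R + 1) = - i%:R :> R by ring.
  rewrite telescope_sumr// /F opprK subr0 step_eq0 ?oppr0 ?add0r.
    by rewrite step_eq1// lerDr mulr_ge0 ?invr_ge0 ?ltW.
  have : h^-1 * x <= N%:R by rewrite ler_pdivrMl// hN ltW.
  rewrite -natr1; lra.
pose f x := \sum_(0 <= i < N.+1) c i * hat i x.
exists f, h, (T - h); split => //.
- by apply: smooth_sum => i; apply: smoothZ; exact: shat.
- rewrite ltrBrDr -hN; nra.
- by rewrite ltrBlDr ltrDl.
split.
- move=> x xh; rewrite /f big_nat_cond big1// => i _.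
  rewrite /c; case: ifPn => [/andP[i2 iN]|_]; last by rewrite mul0r.
  rewrite hat_eq0 ?mulr0//.
  have i2' : 2 <= i%:R :> R by rewrite ler_nat.
  have iN' : i%:R + 2 <= N%:R :> R by rewrite -natrD ler_nat addn2.
  move: xh; rewrite in_itv/= negb_and -!ltNge => /orP[xh|xh].
    rewrite ler_normr; apply/orP; right; nra.
  rewrite ler_normr; apply/orP; left; rewrite -hN in xh; nra.
- move=> x xT.
  have -> : v x = w x by rewrite /w patchE mem_setE xT.
  (* Because the hats sum to 1, the error is an average of [w x - c i] in which only the nodes
     within h of x have nonzero weight. *)
  have -> : w x - f x = \sum_(0 <= i < N.+1) (w x - c i) * hat i x.
    rewrite -[w x]mulr1 -{1}(hat1 x xT) mulr_sumr -sumrB.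
    by apply: eq_bigr => i _; rewrite mulr1 mulrBl.
  apply: le_trans (ler_norm_sum _ _ _) _.
  rewrite -[leRHS]mulr1 -(hat1 x xT) mulr_sumr; apply: ler_sum_nat => i /andP[_ iN].
  rewrite normrM (ger0_norm (hat_ge0 _ _)).
  have [/hat_eq0 ->|xi] := leP h `|x - i%:R * h|; first by rewrite !mulr0.
  apply: ler_wpM2r => //.
  have xcc : x \in `[0, T] by move: xT; rewrite !in_itv/= => /andP[/ltW -> /ltW ->].
  rewrite /c; case: ifPn => [_|].
    by apply: hd => //; apply: lt_trans xi _; lra.
  move: xi; rewrite ltr_norml => /andP[xi1 xi2].
  rewrite negb_and -!ltnNge => /orP[i2|i2].
    have i2' : i%:R <= 1%:R :> R by rewrite ler_nat -ltnS.
    rewrite -(w0 0) ?in_itv/= ?ltxx//; apply: hd => //.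
    move: xT; rewrite in_itv/= => /andP[x0 _].
    by rewrite subr0 gtr0_norm//; nra.
  have i2' : N%:R <= i%:R + 1 :> R.
    by rewrite natr1 ler_nat; move: i2; rewrite /N/= ltnS.
  rewrite -(w0 T) ?in_itv/= ?ltxx ?andbF//; apply: hd => //.
  move: xT; rewrite in_itv/= => /andP[_ xT].
  by rewrite distrC gtr0_norm ?subr_gt0// -hN; nra.
Qed.

End density.

(** * The inner product of L2(0,T) *)

Section interval_L2.
Context {R : realType}.
Variable T : R.
Local Notation mu := (@lebesgue_measure R).
Implicit Types g h : L2 T.

(** [L2 T] integrates a restricted measure over the whole line, while distributional pairings
    integrate Lebesgue measure over ]0, T[; this passes from one to the other. *)
Lemma integral_leb0T (f : measurableTypeR R -> \bar R) : measurable_fun setT f ->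
  (\int[leb0T T]_x f x = \int[mu]_(x in [set` `]0%R, T[%R]) f x)%E.
Proof.
move=> mf; rewrite -(@eq_measure_integral _ _ _ _ mu (leb0T T)); last first.
  by move=> A mA AT; rewrite /= /leb0T /mrestr setIidl.
rewrite [RHS]integral_mkcond; apply: ae_eq_integral => //.
- by apply/measurable_restrict => //; rewrite setTI; exact: measurable_funTS.
- by apply: ae_leb0T => x xT _; rewrite patchE mem_setE xT.
Qed.

Lemma integrable_leb0T (f : measurableTypeR R -> R) :
  (leb0T T).-integrable setT (EFin \o f) -> mu.-integrable `]0, T[ (EFin \o f).
Proof.
move=> /integrableP[mf fi]; apply/integrableP; split.
  exact: measurable_funTS.
by rewrite -integral_leb0T//; exact: measurableT_comp.
Qed.

Lemma L2_measurable g : measurable_fun setT (g : R -> R).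
Proof. exact: (@measurable_funPT _ _ (measurableTypeR R) (measurableTypeR R) g). Qed.

Lemma L2_mul_integrable g h :
  (leb0T T).-integrable setT (EFin \o (fun x => g x * h x)).
Proof.
apply/Lfun1_integrable; exact: (Lfun2_mul_Lfun1 (Lfun_L2 g) (Lfun_L2 h)).
Qed.

Lemma L2_integrable_leb0T g : (leb0T T).-integrable setT (EFin \o g).
Proof.
apply/Lfun1_integrable; apply: (Lfun_subset12 _ (Lfun_L2 g)).
by rewrite ge0_fin_numE// leb0T_fin.
Qed.

Lemma L2_integrable_oo g : mu.-integrable `]0, T[ (EFin \o g).
Proof. exact: integrable_leb0T (L2_integrable_leb0T g). Qed.

Lemma dotC g h : dot g h = dot h g.
Proof. by rewrite /dot; apply: eq_Rintegral => x _; rewrite mulrC. Qed.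

Lemma dot_ae g (k : R -> R) h : measurable_fun setT k ->
  (\forall x \ae leb0T T, h x = k x) -> dot g h = \int[leb0T T]_x (g x * k x).
Proof.
move=> mk hk; congr fine; apply: ae_eq_integral => //.
- by apply/measurable_EFinP; apply: measurable_funM; exact: L2_measurable.
- by apply/measurable_EFinP; apply: measurable_funM => //; exact: L2_measurable.
- by apply: filterS hk => x /= -> _.
Qed.

Lemma dotDZr g (a : R) h k : dot g (a *: h + k) = a * dot g h + dot g k.
Proof.
rewrite (@dot_ae _ (fun x => a * h x + k x)); last 2 first.
- by apply: measurable_funD; [apply: measurable_funM|]; try exact: L2_measurable.
- apply: filterS2 (L2_addE (a *: h) k) (L2_scaleE a h) => x -> ->.
  by [].
rewrite -RintegralZl//; last exact: L2_mul_integrable.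
rewrite -RintegralD//; last 2 first.
- rewrite (_ : EFin \o _ = (fun x => a%:E * (EFin \o (fun x => (g x * h x)%R)) x)%E)//.
  by apply: integrableZl => //; exact: L2_mul_integrable.
- exact: L2_mul_integrable.
by apply: eq_Rintegral => x _; rewrite /=; ring.
Qed.

Lemma dot0r g : dot g 0 = 0.
Proof. by have := dotDZr g 1 0 0; rewrite scaler0 addr0 mul1r; lra. Qed.

Lemma dotDr g h k : dot g (h + k) = dot g h + dot g k.
Proof. by have := dotDZr g 1 h k; rewrite scale1r mul1r. Qed.

Lemma dotZr g (a : R) h : dot g (a *: h) = a * dot g h.
Proof. by have := dotDZr g a h 0; rewrite dot0r !addr0. Qed.

Lemma dotNr g h : dot g (- h) = - dot g h.
Proof. by rewrite -scaleN1r dotZr mulN1r. Qed.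

Lemma dotBl g h k : dot (g - h) k = dot g k - dot h k.
Proof. by rewrite !(dotC _ k) dotDr dotNr. Qed.

Lemma dot_sumr g (s : seq (L2 T)) (F : L2 T -> L2 T) :
  dot g (\sum_(v <- s) F v) = \sum_(v <- s) dot g (F v).
Proof.
elim: s => [|v s IH]; first by rewrite !big_nil dot0r.
by rewrite !big_cons dotDr IH.
Qed.

(** Cauchy-Schwarz, as Hölder's inequality with both exponents equal to 2. *)
Lemma dot_norm g h : `|dot g h| <= `|g| * `|h|.
Proof.
have gE (k : L2 T) : 'N[leb0T T]_2%:E[EFin \o k]%E \is a fin_num :> bool.
  have := Lfun_L2 k; rewrite inE => /andP[_]; rewrite inE/= /finite_norm => kfin.
  by rewrite ge0_fin_numE// Lnorm_ge0.
rewrite !L2_normE -fineM; [|exact: gE..].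
apply: le_trans (le_normr_Rintegral measurableT (L2_mul_integrable g h)) _.
apply: fine_le.
- have /integrableP[_] := integrable_norm (L2_mul_integrable g h).
  rewrite ge0_fin_numE; last by apply: integral_ge0 => x _; rewrite lee_fin.
  apply: le_lt_trans; rewrite le_eqVlt; apply/orP; left; apply/eqP.
  by apply: eq_integral => x _ /=; rewrite normr_id.
- by rewrite fin_numM//; exact: gE.
have := @hoelder _ _ _ (leb0T T) (g : R -> R) (h : R -> R) 2 2
  (L2_measurable g) (L2_measurable h).
rewrite ltr0n => /(_ isT isT); rewrite -div1r -splitr => /(_ erefl).
apply: le_trans; rewrite Lnorm1; exact: lexx.
Qed.

End interval_L2.

(** * C0(0,T), its dual, and functions of bounded variation *)

(** This includes sets without a supremum, for which [sup] takes the default value 0. *)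
Lemma sup_nonneg {R : realType} (S : set R) :
  (forall x, S x -> 0 <= x) -> 0 <= sup S.
Proof.
move=> S0; have [[[x Sx] ub]|/sup_out ->//] := pselect (has_sup S).
exact: le_trans (S0 _ Sx) (ub_le_sup ub Sx).
Qed.

Section C0_and_M.
Context {R : realType}.
Variable T : R.
Hypothesis T0 : 0 < T.
Local Notation mu := (@lebesgue_measure R).
Implicit Types (u v w f phi : R -> R) (m n : (R -> R) -> R).

Lemma C0_bounded v : C0 T v -> exists2 c, 0 <= c &
  forall x, x \in `]0, T[ -> `|v x| <= c.
Proof.
move=> Cv; have cw := C0_patch_continuous T0 Cv.
have cn : {within `[0, T], continuous (fun x => `|(v \_ `]0, T[) x|)}.
  by apply: continuous_subspaceT => x; apply: cvg_norm; exact: cw.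
have [c _ hc] := EVT_max (ltW T0) cn.
exists `|(v \_ `]0, T[) c| => // x xT.
have xcc : x \in `[0, T] by move: xT; rewrite !in_itv/= => /andP[/ltW -> /ltW ->].
by apply: le_trans (hc _ xcc); rewrite patchE mem_setE xT.
Qed.

Lemma normC_ge v x : C0 T v -> x \in `]0, T[ -> `|v x| <= normC T v.
Proof.
move=> /C0_bounded[c _ hc] xT; apply: ub_le_sup; last by exists x.
by exists c => _ [y yT <-]; exact: hc.
Qed.

Lemma normC_le v (c : R) : (forall x, x \in `]0, T[ -> `|v x| <= c) ->
  normC T v <= c.
Proof.
move=> hc; apply: ge_sup; last by move=> _ [y yT <-]; exact: hc.
exists `|v (T / 2)|, (T / 2) => //=.
by rewrite in_itv/= divr_gt0//= ltr_pdivrMr// ltr_pMr// ltr1n.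
Qed.

Lemma normC_ge0 v : 0 <= normC T v.
Proof. by apply: sup_nonneg => _ [y _ <-]. Qed.

Lemma normC_cst0 : normC T (cst 0) = 0.
Proof.
by apply/eqP; rewrite eq_le normC_ge0 andbT normC_le// => x _; rewrite normr0.
Qed.

Lemma C0_cst0 : C0 T (cst 0).
Proof. by split; [move=> x _; exact: cst_continuous|exact: cvg_cst..]. Qed.

Lemma C0_lin (a : R) v w : C0 T v -> C0 T w -> C0 T (fun x => a * v x + w x).
Proof.
move=> [cv v0 vT] [cw w0 wT]; split.
- move=> x xT; apply: cvgD; last exact: cw.
  by apply: cvgM; [exact: cvg_cst|exact: cv].
- rewrite -[X in _ --> X]addr0 -[X in _ --> X + _](mulr0 a).
  by apply: cvgD => //; apply: cvgM => //; exact: cvg_cst.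
- rewrite -[X in _ --> X]addr0 -[X in _ --> X + _](mulr0 a).
  by apply: cvgD => //; apply: cvgM => //; exact: cvg_cst.
Qed.

Lemma C0Z (a : R) v : C0 T v -> C0 T (fun x => a * v x).
Proof.
move=> Cv; have := C0_lin a Cv C0_cst0.
by under [X in C0 _ X -> _]eq_fun do rewrite addr0.
Qed.

Lemma C0B v w : C0 T v -> C0 T w -> C0 T (fun x => v x - w x).
Proof.
move=> Cv Cw; have := C0_lin (-1) Cw Cv.
by under [X in C0 _ X -> _]eq_fun do rewrite mulN1r addrC.
Qed.

Lemma C0_supported f (a b : R) : continuous f -> 0 < a -> b < T ->
  (forall x, x \notin `[a, b] -> f x = 0) -> C0 T f.
Proof.
move=> cf a0 bT f0; split=> [x _||]; first exact: cf.
- rewrite -[X in _ --> X](f0 0); last by rewrite in_itv/= leNgt a0.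
  by apply: cvg_at_right_filter; exact: cf.
- rewrite -[X in _ --> X](f0 T); last by rewrite in_itv/= [T <= b]leNgt bT andbF.
  by apply: cvg_at_left_filter; exact: cf.
Qed.

Lemma in_M_lin m (a : R) v w : in_M T m -> C0 T v -> C0 T w ->
  m (fun x => a * v x + w x) = a * m v + m w.
Proof. by case=> + _; apply. Qed.

Lemma in_M_cst0 m : in_M T m -> m (cst 0) = 0.
Proof.
move=> hm; have := in_M_lin 1 hm C0_cst0 C0_cst0.
rewrite (_ : (fun _ => _) = cst 0); last by apply/funext => x /=; rewrite mulr0 addr0.
by lra.
Qed.

Lemma in_MZ m (a : R) v : in_M T m -> C0 T v -> m (fun x => a * v x) = a * m v.
Proof.
move=> hm Cv; have := in_M_lin a hm Cv C0_cst0.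
by under [X in m X = _ -> _]eq_fun do rewrite addr0; rewrite in_M_cst0// addr0.
Qed.

Lemma in_MB m v w : in_M T m -> C0 T v -> C0 T w ->
  m (fun x => v x - w x) = m v - m w.
Proof.
move=> hm Cv Cw; have := in_M_lin (-1) hm Cw Cv.
by under [X in m X = _ -> _]eq_fun do rewrite mulN1r addrC; rewrite mulN1r addrC.
Qed.

Lemma normM_ge0 m : 0 <= normM T m.
Proof. by apply: sup_nonneg => _ [v _ <-]. Qed.

Lemma normM_le m (c : R) :
  (forall v, C0 T v -> normC T v <= 1 -> `|m v| <= c) -> normM T m <= c.
Proof.
move=> hc; apply: ge_sup; last by move=> _ [v [Cv v1] <-]; exact: hc.
by exists `|m (cst 0)|, (cst 0) => //; split; [exact: C0_cst0|rewrite normC_cst0].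
Qed.

Lemma normM_ge m v : in_M T m -> C0 T v -> normC T v <= 1 -> `|m v| <= normM T m.
Proof.
move=> [_ [c hc]] Cv v1; apply: ub_le_sup; last by exists v.
exists `|c| => _ [w [Cw w1] <-]; apply: le_trans (hc _ Cw) _.
apply: le_trans (ler_norm _) _; rewrite normrM ler_piMr//.
by rewrite ger0_norm// normC_ge0.
Qed.

Lemma normM_pairing m v : in_M T m -> C0 T v -> `|m v| <= normM T m * normC T v.
Proof.
move=> hm Cv; have := normC_ge0 v; rewrite le_eqVlt => /predU1P[v0|v0].
  (* A function of norm 0 cannot be normalized; here the constant in [in_M] bounds [m v] by 0
     directly. *)
  case: hm => _ [c hc]; have := hc _ Cv; rewrite -v0 !mulr0; exact.
have CZ := C0Z (normC T v)^-1 Cv.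
have hZ : normC T (fun x => (normC T v)^-1 * v x) <= 1.
  apply: normC_le => x xT.
  by rewrite normrM normfV (ger0_norm (normC_ge0 v)) ler_pdivrMl// mulr1 normC_ge.
have := normM_ge hm CZ hZ.
by rewrite in_MZ// normrM normfV (ger0_norm (normC_ge0 v)) ler_pdivrMl// mulrC.
Qed.

Lemma in_M_cst : in_M T (cst 0).
Proof.
split=> [a v w _ _|]; first by rewrite /= mulr0 addr0.
by exists 0 => v _; rewrite normr0 mul0r.
Qed.

Lemma in_M_comb (a : R) m n : in_M T m -> in_M T n ->
  in_M T (fun v => a * m v + n v).
Proof.
move=> hm hn; split=> [b v w Cv Cw|].
  by rewrite !in_M_lin//; ring.
exists (`|a| * normM T m + normM T n) => v Cv.
apply: le_trans (ler_normD _ _) _; rewrite mulrDl normrM -mulrA.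
by apply: lerD; [apply: ler_wpM2l => //|]; exact: normM_pairing.
Qed.

Lemma normM_comb (a : R) m n : in_M T m -> in_M T n ->
  normM T (fun v => a * m v + n v) <= `|a| * normM T m + normM T n.
Proof.
move=> hm hn; apply: normM_le => v Cv v1.
apply: le_trans (ler_normD _ _) _; rewrite normrM.
by apply: lerD; [apply: ler_wpM2l => //|]; exact: normM_ge.
Qed.

Lemma in_M_dirac x : x \in `]0, T[ -> in_M T (fun v => v x).
Proof.
move=> xT; split=> // ; exists 1 => v Cv; rewrite mul1r; exact: normC_ge.
Qed.

Lemma normM_dirac x : x \in `]0, T[ -> normM T (fun v => v x) <= 1.
Proof. by move=> xT; apply: normM_le => v Cv; apply: le_trans; exact: normC_ge. Qed.

Lemma normM_cst0 : normM T (cst 0) = 0.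
Proof.
by apply/eqP; rewrite eq_le normM_ge0 andbT normM_le// => v _ _; rewrite normr0.
Qed.

Lemma C0_measurable v : C0 T v -> measurable_fun `]0, T[ v.
Proof.
move=> [cv _ _]; apply: open_continuous_measurable_fun; first exact: interval_open.
by move=> x; rewrite inE; exact: cv.
Qed.

Lemma mul_bounded_integrable w f (c : R) :
  mu.-integrable `]0, T[ (EFin \o w) -> measurable_fun `]0, T[ f ->
  (forall x, x \in `]0, T[ -> `|f x| <= c) ->
  mu.-integrable `]0, T[ (EFin \o (fun x => w x * f x)).
Proof.
move=> wi mf fc; have mw : measurable_fun `]0, T[ w.
  by apply/measurable_EFinP; exact: measurable_int wi.
have wc : mu.-integrable `]0, T[ (fun x => c%:E * (EFin \o w) x)%E.
  exact: integrableZl.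
apply: (le_integrable _ _ _ wc) => //.
  by apply/measurable_EFinP; exact: measurable_funM.
move=> x xT; rewrite /= lee_fin !normrM mulrC ler_wpM2r//.
exact: le_trans (fc _ xT) (ler_norm _).
Qed.

Lemma L1_pairing_integrable w v : mu.-integrable `]0, T[ (EFin \o w) -> C0 T v ->
  mu.-integrable `]0, T[ (EFin \o (fun x => w x * v x)).
Proof.
move=> wi Cv; have [c _ hc] := C0_bounded Cv.
exact: mul_bounded_integrable wi (C0_measurable Cv) hc.
Qed.

Lemma L1_pairing_bound w f (c : R) : 0 <= c ->
  mu.-integrable `]0, T[ (EFin \o w) -> measurable_fun `]0, T[ f ->
  (forall x, x \in `]0, T[ -> `|f x| <= c) ->
  `|L1_pairing T w f| <= normL1 T w * c.
Proof.
move=> c0 wi mf fc; have wfi := mul_bounded_integrable wi mf fc.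
apply: le_trans (le_normr_Rintegral _ wfi) _ => //.
rewrite /normL1 -RintegralZr//; last exact: integrable_norm.
apply: le_Rintegral => //.
- exact: integrable_norm.
- rewrite (_ : EFin \o _ = (fun x => c%:E * (EFin \o (fun x => `|w x|)%R) x)%E).
    by apply: integrableZl => //; exact: integrable_norm.
  by apply/funext => x; rewrite /= muleC.
- by move=> x xT; rewrite normrM ler_wpM2l// fc.
Qed.

Lemma in_M_L1 w : mu.-integrable `]0, T[ (EFin \o w) -> in_M T (L1_pairing T w).
Proof.
move=> wi; split=> [a v1 v2 C1 C2|].
  have i1 := L1_pairing_integrable wi C1; have i2 := L1_pairing_integrable wi C2.
  rewrite /L1_pairing -RintegralZl// -RintegralD//; last first.
    rewrite (_ : EFin \o _ = (fun x => a%:E * (EFin \o (fun x => (w x * v1 x))%R) x)%E)//.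
    exact: integrableZl.
  by apply: eq_Rintegral => x _ /=; ring.
exists (normL1 T w) => v Cv; apply: L1_pairing_bound => //.
- exact: normC_ge0.
- exact: C0_measurable.
- by move=> x; exact: normC_ge.
Qed.

End C0_and_M.

(** * Integrals over intervals and Cauchy's formula for iterated integrals *)

Section interval_integrals.
Context {R : realType}.
Local Notation mu := (@lebesgue_measure R).
Implicit Types (f g F : R -> R) (a b c x : R).

Lemma Rintegral_oo_derive F f a b : a <= b -> (forall x, is_derive x (1 : R) F (f x)) ->
  continuous f -> \int[mu]_(x in `]a, b[) f x = F b - F a.
Proof.
rewrite le_eqVlt => /predU1P[<-|ab] Ff cf.
  by rewrite set_itvoo0 Rintegral_set0 subrr.
have fi : mu.-integrable `[a, b] (EFin \o f).
  apply: continuous_compact_integrable; first exact: segment_compact.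
  exact: continuous_subspaceT.
have cF : continuous F.
  by move=> x; apply: differentiable_continuous; apply/derivable1_diffP; apply: ex_derive.
rewrite Rintegral_itv_bndo_bndc; last first.
  by apply: integrableS fi => //; exact: subset_itv_oo_cc.
rewrite Rintegral_itv_obnd_cbnd; last first.
  by apply: integrableS fi => //; exact: subset_itv_oc_cc.
rewrite /Rintegral (@continuous_FTC2 _ f F a b ab)//.
- exact: continuous_subspaceT.
- split=> [x _||]; first exact: ex_derive.
  + exact/cvg_at_right_filter/cF.
  + exact/cvg_at_left_filter/cF.
- by move=> x _; rewrite (derive1_ext Ff).
Qed.

Lemma Rintegral_indic_oo (T a b : R) f : 0 <= a -> b <= T ->
  \int[mu]_(y in `]0, T[) (\1_`]a, b[ y * f y) = \int[mu]_(y in `]a, b[) f y.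
Proof.
move=> a0 bT; rewrite [LHS]Rintegral_mkcond [RHS]Rintegral_mkcond.
congr Rintegral; apply/funext => y; rewrite !patchE !mem_setE indicE mem_setE.
have [yab|yab] := boolP (y \in `]a, b[); last by rewrite mul0r if_same.
rewrite mul1r ifT//; move: yab; rewrite !in_itv/= => /andP[ay yb].
by rewrite (le_lt_trans a0)//= (lt_le_trans yb).
Qed.

Lemma integral_oo_oc f a b : measurable_fun setT f ->
  \int[mu]_(y in `]a, b[) f y = \int[mu]_(y in `]a, b]) f y.
Proof.
move=> mf; rewrite /Rintegral integral_itv_bndo_bndc//.
by apply/measurable_EFinP; exact: measurable_funTS.
Qed.

Lemma integral_oo_cc f a b : measurable_fun setT f ->
  \int[mu]_(y in `]a, b[) f y = \int[mu]_(y in `[a, b]) f y.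
Proof.
move=> mf; rewrite integral_oo_oc// /Rintegral integral_itv_obnd_cbnd//.
by apply/measurable_EFinP; exact: measurable_funTS.
Qed.

Lemma integrable_oo_cc f a b : measurable_fun setT f ->
  mu.-integrable `]a, b[ (EFin \o f) -> mu.-integrable `[a, b] (EFin \o f).
Proof.
move=> mf /integrableP[_ fi]; apply/integrableP; split.
  by apply/measurable_EFinP; exact: measurable_funTS.
rewrite -integral_itv_obnd_cbnd; last first.
  by apply/measurable_funTS; apply: measurableT_comp => //; exact/measurable_EFinP.
rewrite -integral_itv_bndo_bndc//.
by apply/measurable_funTS; apply: measurableT_comp => //; exact/measurable_EFinP.
Qed.

(** Fubini on the triangle y <= s inside the square of side x. The kernel x - y is the one appearing
    in [Kfun], which is how second primitives meet K_x. *)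
Lemma Rintegral_iterated g x : 0 <= x -> measurable_fun setT g ->
  mu.-integrable `]0, x[ (EFin \o g) ->
  \int[mu]_(s in `]0, x[) (\int[mu]_(y in `[0, s]) g y) =
  \int[mu]_(y in `]0, x[) (g y * (x - y)).
Proof.
move=> x0 mg gi; pose I := (`]0, x[%classic : set R).
pose ge0 := (`[0, +oo[%classic : set R).
(* The first coordinate is the outer variable s. Writing the triangle as [0 <= s - y] makes
   measurability a matter of composition. *)
pose h (z : measurableTypeR R * measurableTypeR R) : R :=
  (g z.2 * \1_I z.2) * (\1_I z.1 * \1_ge0 (z.1 - z.2)).
have mI : measurable (I : set (measurableTypeR R)) by exact: measurable_itv.
have mge0 : measurable (ge0 : set (measurableTypeR R)) by exact: measurable_itv.
have mh : measurable_fun setT h.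
  apply: measurable_funM; apply: measurable_funM.
  - exact: measurableT_comp.
  - by apply: (measurableT_comp (f := \1_I : measurableTypeR R -> R)).
  - by apply: (measurableT_comp (f := \1_I : measurableTypeR R -> R)).
  - apply: measurableT_comp; first exact: measurable_indic.
    exact: measurable_funB.
have inI y : (y \in I) = (y \in `]0, x[) by rewrite mem_setE.
have indI y : \1_I y = (y \in `]0, x[)%:R :> R by rewrite indicE inI.
have inge0 y : (y \in ge0) = (0 <= y) by rewrite mem_setE in_itv/= andbT.
have layer (y s : R) : y \in `]0, x[ ->
    \1_I s * \1_ge0 (s - y) = \1_(`[y, x[%classic : set R) s :> R.
  rewrite in_itv/= => /andP[y0 yx].
  rewrite !indicE inI inge0 mem_setE !in_itv/= subr_ge0 -natrM mulnb.
  congr (nat_of_bool _)%:R; have [ys|] := leP y s; last by rewrite andbF.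
  by rewrite andbT (lt_le_trans y0).
have yxfin y : y \in `]0, x[ -> lebesgue_measure `[y, x[%classic = (x - y)%:E.
  rewrite in_itv/= => /andP[y0 yx].
  by rewrite lebesgue_measure_itv/= lte_fin yx EFinB.
have slice2 y (c : R) : y \in `]0, x[ ->
    (\int[mu]_s (c * (\1_I s * \1_ge0 (s - y)))%:E = (c * (x - y))%:E)%E.
  move=> yI;
  transitivity (\int[mu]_s (c%:E * (\1_(`[y, x[%classic : set R) s)%:E))%E.
    by apply: eq_integral => s _; rewrite -EFinM layer.
  rewrite integralZl//; last first.
    exact: integrable_indic_itv.
  by rewrite integral_indic//= setIT yxfin.
pose K y := g y * (x - y).
have iK : mu.-integrable `]0, x[ (EFin \o K).
  apply: (mul_bounded_integrable (c := x)) => //.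
    by apply: measurable_funTS; exact: measurable_funB.
  move=> y; rewrite in_itv/= => /andP[y0 yx].
  by rewrite ger0_norm ?subr_ge0 ?(ltW yx)// gerBl ltW.
have slice1 s : (\int[mu]_y (h (s, y))%:E =
    (((fun s => \int[mu]_(y in `[0, s]) g y) \_ `]0%R, x[) s)%:E)%E.
  rewrite patchE mem_setE; case: ifPn => sI; last first.
    apply: integral0_eq => y _; congr EFin.
    by rewrite /h/= (indI s) (negbTE sI) mul0r mulr0.
  rewrite -integral_oo_cc// integral_oo_oc// /Rintegral fineK; last first.
    apply: integrable_fin_num => //; apply: integrableS gi => //.
    move: sI; rewrite in_itv/= => /andP[s0 sx].
    by apply: subset_itvl; rewrite bnd_simp.
  rewrite [RHS]integral_mkcond; apply: eq_integral => y _.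
  rewrite patchE mem_setE /h/= !indicE !inI inge0 sI mul1r subr_ge0.
  move: sI; rewrite !in_itv/= => /andP[s0 sx].
  have [y0|y0] := ltP 0 y; last by rewrite /= mulr0 mul0r.
  have [ys|ys] := leP y s; last by rewrite /= mulr0.
  by rewrite /= (le_lt_trans ys sx) !mulr1.
(* By Tonelli: integrating the absolute value in s first leaves |g y| (x - y), which is integrable
   because the kernel is bounded by x. *)
have int_h : (mu \x mu)%E.-integrable setT (EFin \o h).
  apply/integrable21ltyP; first exact/measurable_EFinP.
  have /integrableP[_] := iK; apply: le_lt_trans; rewrite le_eqVlt.
  apply/orP; left; apply/eqP; rewrite [RHS]integral_mkcond.
  apply: eq_integral => y _; rewrite patchE mem_setE; case: ifPn => yI; last first.
    apply: integral0_eq => s _ /=; congr EFin.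
    by rewrite /h/= (indI y) (negbTE yI) mulr0 mul0r normr0.
  transitivity (\int[mu]_s (`|g y| * (\1_I s * \1_ge0 (s - y)))%:E)%E.
    apply: eq_integral => s _; rewrite /h/= (indI y) yI mulr1 normrM.
    by congr (_ * _)%:E; rewrite ger0_norm// mulr_ge0.
  rewrite slice2// /K/= normrM [X in _ = (_ * X)%:E]ger0_norm// subr_ge0 ltW//.
  by move: yI; rewrite in_itv/= => /andP[].
have slice3 y : (\int[mu]_s (h (s, y))%:E = ((K \_ `]0%R, x[) y)%:E)%E.
  rewrite patchE mem_setE; case: ifPn => yI; last first.
    apply: integral0_eq => s _ /=; congr EFin.
    by rewrite /h/= (indI y) (negbTE yI) mulr0 mul0r.
  rewrite -slice2//; apply: eq_integral => s _.
  by rewrite /h/= (indI y) yI mulr1.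
have := Fubini int_h; rewrite /=.
under eq_integral do rewrite slice1.
under [RHS]eq_integral do rewrite slice3.
move=> /(congr1 fine) E; rewrite [RHS]Rintegral_mkcond.
exact: etrans (Rintegral_mkcond _ _ _) E.
Qed.

End interval_integrals.

(** * Primitives of an L2 function orthogonal to the affine functions *)

Section gradient_primitives.
Context {R : realType}.
Variable T : R.
Hypothesis T0 : 0 < T.
Local Notation mu := (@lebesgue_measure R).
Implicit Types g : L2 T.

Lemma L2_integrable_cc g : mu.-integrable `[0, T] (EFin \o g).
Proof. exact: integrable_oo_cc (L2_measurable g) (L2_integrable_oo g). Qed.

Lemma L2_integrable_sub g (a b : R) : 0 <= a -> b <= T ->
  mu.-integrable `]a, b[ (EFin \o g).
Proof.
move=> a0 bT; apply: integrableS (L2_integrable_cc g) => //.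
by apply: subset_itvW.
Qed.

Lemma dot_L2class g (k : R -> R) (Lk : k \in Lfun (leb0T T) 2%:E) :
  measurable_fun setT k ->
  dot g (L2class (Lfun_Sub (lee1n 2) Lk)) = \int[mu]_(x in `]0, T[) (g x * k x).
Proof.
move=> mk; rewrite (@dot_ae R T g k _ mk); last exact: L2classE.
rewrite /Rintegral integral_leb0T//.
by apply/measurable_EFinP; apply: measurable_funM => //; exact: L2_measurable.
Qed.

Lemma affine_measurable (c d : R) : measurable_fun setT (fun x : R => c * x + d).
Proof. by apply: measurable_funD => //; exact: measurable_funM. Qed.

Lemma Sfun_measurable (x : R) : measurable_fun setT (Sfun T x).
Proof. exact: measurable_indic. Qed.

Lemma Kfun_measurable (x : R) : measurable_fun setT (Kfun T x).
Proof.
have mId := @measurable_id _ _ [set: measurableTypeR R].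
by rewrite /Kfun; case: (x < T / 2); apply: measurable_funM;
  [exact: measurable_indic | exact: measurable_funB|
   exact: measurable_indic | exact: measurable_funB].
Qed.

Lemma prim1E g x : prim1 g x = \int[mu]_(s in `]0, x[) g s.
Proof. by rewrite /prim1 integral_oo_cc//; exact: L2_measurable. Qed.

Lemma prim1_within_continuous g : {within `[0, T], continuous (prim1 g)}.
Proof. exact: parameterized_integral_continuous (ltW T0) (L2_integrable_cc g). Qed.

Variable g : L2 T.
Hypothesis g_affine : forall l, affine l -> dot g l = 0.

Lemma moments (c d : R) : \int[mu]_(x in `]0, T[) (g x * (c * x + d)) = 0.
Proof.
rewrite -(dot_L2class g (affine_Lfun T c d)); last exact: affine_measurable.
by apply: g_affine; exists c, d.
Qed.

Lemma prim1_0 : prim1 g 0 = 0.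
Proof. by rewrite prim1E set_itvoo0 Rintegral_set0. Qed.

Lemma prim1_T : prim1 g T = 0.
Proof.
rewrite prim1E -[RHS](moments 0 1); apply: eq_Rintegral => x _.
by rewrite mul0r add0r mulr1.
Qed.

Lemma prim1_C0 : C0 T (prim1 g).
Proof.
have /(continuous_within_itvP _ T0)[c1 c2 c3] := @prim1_within_continuous g.
by split; [exact: c1|rewrite -[X in _ --> X]prim1_0|rewrite -[X in _ --> X]prim1_T].
Qed.

Lemma prim2E x : x <= T -> prim2 g x = - \int[mu]_(s in `]0, x[) prim1 g s.
Proof.
move=> xT; congr (- _).
have mp : measurable_fun (`[0, x]%classic : set R) (prim1 g).
  have cp : {within `[0, x], continuous (prim1 g)}.
    apply: continuous_subspaceW (@prim1_within_continuous g).
    by apply: subset_itvl; rewrite bnd_simp.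
  exact: subspace_continuous_measurable_fun.
have [x0|x0] := ltP x 0.
  by rewrite !set_itv_ge ?Rintegral_set0// bnd_simp -?leNgt -?ltNge// ltW.
rewrite /Rintegral -integral_itv_obnd_cbnd.
  rewrite -integral_itv_bndo_bndc//.
  apply/measurable_EFinP; apply: measurable_funS mp => //.
  exact: subset_itv_oo_cc.
apply/measurable_EFinP; apply: measurable_funS mp => //.
exact: subset_itv_oc_cc.
Qed.

Lemma prim2_moment x : 0 <= x <= T ->
  prim2 g x = - \int[mu]_(y in `]0, x[) (g y * (x - y)).
Proof.
move=> /andP[x0 xT]; rewrite prim2E// -Rintegral_iterated//.
- exact: L2_measurable.
- exact: L2_integrable_sub.
Qed.

Lemma prim2_0 : prim2 g 0 = 0.
Proof. by rewrite prim2E ?(ltW T0)// set_itvoo0 Rintegral_set0 oppr0. Qed.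

(** Up to sign, the value at T is the pairing of [g] with the affine function T - y. *)
Lemma prim2_T : prim2 g T = 0.
Proof.
rewrite prim2_moment ?lexx ?ltW//.
rewrite (@eq_Rintegral _ _ _ _ _ (fun y => g y * (-1 * y + T))).
  by rewrite moments oppr0.
by move=> y _; rewrite mulN1r addrC.
Qed.

Lemma prim2_C0 : C0 T (prim2 g).
Proof.
have c1 : {within `[0, T], continuous (prim2 g)}.
  have h : {within `[0, T], continuous (fun x => \int[mu]_(s in `[0, x]) prim1 g s)}.
    apply: parameterized_integral_continuous (ltW T0) _.
    apply: continuous_compact_integrable; first exact: segment_compact.
    exact: prim1_within_continuous.
  by move=> x; apply: cvgN; exact: h.
have /(continuous_within_itvP _ T0)[h1 h2 h3] := c1.
by split; [exact: h1|rewrite -[X in _ --> X]prim2_0|rewrite -[X in _ --> X]prim2_T].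
Qed.

(** The total integral of [g] is 0, so its integral over ]x, T[ is minus the one over ]0, x[. *)
Lemma dot_SL2 x : x \in `]0, T[ -> dot g (SL2 T x) = - prim1 g x.
Proof.
rewrite in_itv/= => /andP[x0 xT].
rewrite dot_L2class; last exact: Sfun_measurable.
have -> : \int[mu]_(y in `]0, T[) (g y * Sfun T x y) = \int[mu]_(y in `]x, T[) g y.
  rewrite -(Rintegral_indic_oo _ (ltW x0) (lexx T)); apply: eq_Rintegral => y _.
  by rewrite mulrC.
have := Rintegral_itvB (L2_integrable_cc g) (x := x).
rewrite !bnd_simp => /(_ (ltW x0) (ltW xT)).
rewrite -/(prim1 g T) -/(prim1 g x) prim1_T sub0r => ->.
by rewrite integral_oo_oc//; exact: L2_measurable.
Qed.

(** The two branches of [Kfun] are the negative and the positive part of y - x; they differ by an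
    affine function, which [g] annihilates, so both give the same value. *)
Lemma dot_KL2 x : x \in `]0, T[ -> dot g (KL2 T x) = - prim2 g x.
Proof.
rewrite in_itv/= => /andP[x0 xT].
have mg := L2_measurable g.
rewrite dot_L2class; last exact: Kfun_measurable.
rewrite prim2_moment ?(ltW x0) ?(ltW xT)// opprK /Kfun.
case: (x < T / 2).
  rewrite -(Rintegral_indic_oo _ (lexx 0) (ltW xT)).
  by apply: eq_Rintegral => y _; ring.
have mh : measurable_fun setT (fun y : R => g y * (x - y)).
  by apply: measurable_funM => //; exact: measurable_funB.
have hi : mu.-integrable `[0, T] (EFin \o (fun y : R => g y * (x - y))).
  apply: integrable_oo_cc => //.
  apply: (mul_bounded_integrable (c := T)) => //.
  - exact: L2_integrable_oo.
  - by apply: measurable_funTS; exact: measurable_funB.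
  - by move=> y; rewrite in_itv/= => /andP[y0 yT]; rewrite ler_norml; lra.
have := Rintegral_itvB hi (x := x).
rewrite !bnd_simp => /(_ (ltW x0) (ltW xT)).
rewrite -!integral_oo_cc// -integral_oo_oc//.
have -> : \int[mu]_(y in `]0, T[) (g y * (x - y)) = 0.
  rewrite (@eq_Rintegral _ _ _ _ _ (fun y => g y * (-1 * y + x))) ?moments//.
  by move=> y _; rewrite mulN1r addrC.
rewrite sub0r => h.
transitivity (- \int[mu]_(y in `]x, T[) (g y * (x - y))); last by rewrite -h opprK.
rewrite -(Rintegral_indic_oo _ (ltW x0) (lexx T)) -[RHS]mulN1r -RintegralZl//.
  by apply: eq_Rintegral => y _; ring.
rewrite (_ : _ \o _ = EFin \o (fun y => g y * (x - y) * \1_`]x, T[ y)); last first.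
  by apply/funext => y /=; rewrite mulrC.
apply: (mul_bounded_integrable (c := 1)).
- by apply: integrableS hi => //; exact: subset_itv_oo_cc.
- exact: measurable_indic.
- by move=> y _; rewrite indicE; case: (_ \in _); rewrite ?normr1 ?normr0.
Qed.

End gradient_primitives.

(** * Distributional derivatives of S_x, K_x and affine functions *)

Section BV.
Context {R : realType}.
Variable T : R.
Hypothesis T0 : 0 < T.
Local Notation mu := (@lebesgue_measure R).
Implicit Types (u v w f phi : R -> R) (m n : (R -> R) -> R).

Lemma test_smooth phi : test_function T phi -> smooth phi.
Proof. by case. Qed.

Lemma test_outside phi x : test_function T phi -> x \notin `]0, T[ -> phi x = 0.
Proof.
move=> [_ _ sub] xT; apply/eqP; apply: contraNT xT => phix.
by apply: sub; apply: subset_closure.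
Qed.

Lemma continuous_bounded_itv f : continuous f ->
  exists2 c, 0 <= c & forall x, x \in `]0, T[ -> `|f x| <= c.
Proof.
move=> cf; have cn : {within `[0, T], continuous (fun x => `|f x|)}.
  by apply: continuous_subspaceT => x; apply: cvg_norm; exact: cf.
have [c _ hc] := EVT_max (ltW T0) cn.
exists `|f c| => // x xT; apply: hc.
by move: xT; rewrite !in_itv/= => /andP[/ltW -> /ltW ->].
Qed.

Lemma L1_pairing_lin (a c : R) u v f : mu.-integrable `]0, T[ (EFin \o u) ->
  mu.-integrable `]0, T[ (EFin \o v) -> measurable_fun `]0, T[ f ->
  (forall x, x \in `]0, T[ -> `|f x| <= c) ->
  L1_pairing T (fun x => a * u x + v x) f = a * L1_pairing T u f + L1_pairing T v f.
Proof.
move=> ui vi mf hc.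
have i1 := mul_bounded_integrable ui mf hc.
have i2 := mul_bounded_integrable vi mf hc.
rewrite /L1_pairing -RintegralZl// -RintegralD//; last first.
  rewrite (_ : EFin \o _ = (fun x => a%:E * (EFin \o (fun x => (u x * f x))%R) x)%E)//.
  exact: integrableZl.
by apply: eq_Rintegral => x _ /=; ring.
Qed.

Lemma integrable_lin (a : R) u v : mu.-integrable `]0, T[ (EFin \o u) ->
  mu.-integrable `]0, T[ (EFin \o v) ->
  mu.-integrable `]0, T[ (EFin \o (fun x => a * u x + v x)).
Proof.
move=> ui vi.
rewrite (_ : EFin \o _ = (fun x => a%:E * (EFin \o u) x) \+ (EFin \o v))%E//.
by apply: integrableD => //; exact: integrableZl.
Qed.

Lemma BV_with_lin (a : R) u v m n : BV_with T u m -> BV_with T v n ->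
  BV_with T (fun x => a * u x + v x) (fun f => a * m f + n f).
Proof.
move=> [ui hm um] [vi hn vn]; split; first exact: integrable_lin.
  exact: in_M_comb.
move=> phi tphi.
have cdphi := smooth_continuous (smooth_derive1 (test_smooth tphi)).
have [c _ hc] := continuous_bounded_itv cdphi.
rewrite um// vn// (L1_pairing_lin _ _ _ _ hc)//; first by ring.
by apply: measurable_funTS; exact: continuous_measurable_fun.
Qed.

(** An element of [L2 T] coerces to an unspecified representative; facts proved for explicit
    formulas are carried over to that representative. *)
Lemma BV_with_ae u v m : measurable_fun setT u -> measurable_fun setT v ->
  (\forall x \ae leb0T T, u x = v x) -> BV_with T u m -> BV_with T v m.
Proof.
move=> mu_ mv uv [ui hm um].
have [N [mN N0 sN]] := uv.
(* The restricted measure of [N] is the Lebesgue measure of its trace on ]0, T[, which is therefore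
   a null exceptional set. *)
have aeP (h k : R -> \bar R) : (forall x, u x = v x -> h x = k x) ->
    ae_eq mu (`]0, T[%classic : set R) h k.
  move=> hk; exists (N `&` `]0, T[); split => //.
    by apply: measurableI.
  move=> x /= nhk; have xT : x \in `]0, T[.
    by apply: contrapT => xT; apply: nhk => /xT.
  split => //; apply: sN => /= uvx; apply: nhk => _; exact: hk.
split=> //.
- have /integrableP[_ ufin] := ui; apply/integrableP; split.
    by apply/measurable_EFinP; exact: measurable_funTS.
  suff <- : (\int[mu]_(x in [set` `]0%R, T[%R]) `|(EFin \o u) x| =
             \int[mu]_(x in [set` `]0%R, T[%R]) `|(EFin \o v) x|)%E by [].
  apply: ae_eq_integral => //.
  + by apply: measurableT_comp => //; apply/measurable_EFinP; exact: measurable_funTS.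
  + by apply: measurableT_comp => //; apply/measurable_EFinP; exact: measurable_funTS.
  + by apply: aeP => x /= ->.
- move=> phi tphi; rewrite um//; congr (- fine _).
  have mphi : measurable_fun setT (phi^`())%classic.
    apply: continuous_measurable_fun; apply: smooth_continuous.
    by apply: smooth_derive1; exact: test_smooth.
  apply: ae_eq_integral => //.
  + by apply/measurable_EFinP; apply: measurable_funTS; exact: measurable_funM.
  + by apply/measurable_EFinP; apply: measurable_funTS; exact: measurable_funM.
  + by apply: aeP => x ->.
Qed.

Lemma test_Rintegral_derive phi (a b : R) : test_function T phi -> a <= b ->
  \int[mu]_(x in `]a, b[) (phi^`())%classic x = phi b - phi a.
Proof.
move=> /test_smooth sphi ab; apply: Rintegral_oo_derive => //.
  by move=> x; apply: is_derive_derive1; exact: smooth_derivable.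
by apply: smooth_continuous; exact: smooth_derive1.
Qed.

Lemma bounded_integrable_oo f (c : R) : measurable_fun setT f ->
  (forall x, `|f x| <= c) -> mu.-integrable `]0, T[ (EFin \o f).
Proof.
move=> mf fc; apply: measurable_bounded_integrable => //.
- by rewrite /= lebesgue_measure_itv/=; case: ifP => _; rewrite ?ltry.
- exact: measurable_funTS.
- exists c; split; first exact: num_real.
  by move=> y cy x _ /=; rewrite (le_trans (fc x))// ltW.
Qed.

Lemma continuous_integrable_oo f (a b : R) : continuous f ->
  mu.-integrable `]a, b[ (EFin \o f).
Proof.
move=> cf; apply: (@integrableS _ _ _ mu `[a, b]) => //.
  exact: subset_itv_oo_cc.
apply: continuous_compact_integrable; first exact: segment_compact.
exact: continuous_subspaceT.
Qed.

Lemma BV_with_Sfun x : x \in `]0, T[ -> BV_with T (Sfun T x) (fun v => v x).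
Proof.
move=> xT; split; last 1 first.
- move=> phi tphi; rewrite /L1_pairing.
  move: (xT); rewrite in_itv/= => /andP[x0 xltT].
  rewrite (Rintegral_indic_oo _ (ltW x0) (lexx T)) test_Rintegral_derive// 1?ltW//.
  by rewrite (test_outside tphi (x := T)) ?in_itv/= ?ltxx ?andbF// sub0r opprK.
- apply: (@bounded_integrable_oo _ 1); first exact: Sfun_measurable.
  by move=> y; rewrite /Sfun indicE; case: (_ \in _); rewrite ?normr1 ?normr0.
- exact: in_M_dirac.
Qed.

Lemma BV_with_cst (c : R) : BV_with T (cst c) (cst 0).
Proof.
split; first by apply: (@bounded_integrable_oo _ `|c|).
  exact: in_M_cst.
move=> phi tphi; rewrite /L1_pairing/= RintegralZl//.
  rewrite test_Rintegral_derive// ?ltW// !(test_outside tphi) ?in_itv/= ?ltxx ?andbF//.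
  by rewrite subrr mulr0 oppr0.
have cphi : continuous (phi^`())%classic.
  by apply: smooth_continuous; apply: smooth_derive1; exact: test_smooth.
exact: continuous_integrable_oo.
Qed.

(** The derivative of [Kfun T x]. Off the point x the two branches differ by the constant 1 on ]0,
    T[, so each jumps up by 1 at x and has the Dirac mass at x as derivative. *)
Definition Kderiv (x y : R) : R :=
  if x < T / 2 then - \1_`]0, x[ y else Sfun T x y.

Lemma Kderiv_measurable (x : R) : measurable_fun setT (Kderiv x).
Proof.
rewrite /Kderiv; case: (x < T / 2); last exact: Sfun_measurable.
by apply: measurable_funN; exact: measurable_indic.
Qed.

Lemma Kderiv_integrable (x : R) : mu.-integrable `]0, T[ (EFin \o Kderiv x).
Proof.
apply: (@bounded_integrable_oo _ 1); first exact: Kderiv_measurable.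
move=> y; rewrite /Kderiv /Sfun; case: (x < T / 2); rewrite ?normrN indicE;
  by case: (_ \in _); rewrite ?normr1 ?normr0.
Qed.

Lemma L1_pairing_Kderiv x f : x \in `]0, T[ ->
  mu.-integrable `]0, T[ (EFin \o f) ->
  L1_pairing T (Kderiv x) f = if x < T / 2 then - \int[mu]_(y in `]0, x[) f y
                              else \int[mu]_(y in `]x, T[) f y.
Proof.
rewrite in_itv/= => /andP[x0 xT] fi; rewrite /L1_pairing /Kderiv.
case: (x < T / 2); last by rewrite Rintegral_indic_oo// ltW.
rewrite -(Rintegral_indic_oo _ (lexx 0) (ltW xT)) -[RHS]mulN1r -RintegralZl//.
  by apply: eq_Rintegral => y _; ring.
rewrite (_ : _ \o _ = EFin \o (fun y => f y * \1_`]0, x[ y)); last first.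
  by apply/funext => y /=; rewrite mulrC.
apply: (mul_bounded_integrable (c := 1)) => //.
by move=> y _; rewrite indicE; case: (_ \in _); rewrite ?normr1 ?normr0.
Qed.

Lemma BV_with_Kderiv x : x \in `]0, T[ -> BV_with T (Kderiv x) (fun v => v x).
Proof.
move=> xT; split; [exact: Kderiv_integrable|exact: in_M_dirac|move=> phi tphi].
have cphi : continuous (phi^`())%classic.
  by apply: smooth_continuous; apply: smooth_derive1; exact: test_smooth.
rewrite L1_pairing_Kderiv//; last exact: continuous_integrable_oo.
move: xT; rewrite in_itv/= => /andP[x0 xT].
rewrite !test_Rintegral_derive// 1?ltW//.
rewrite (test_outside tphi (x := T)) ?in_itv/= ?ltxx ?andbF//.
rewrite (test_outside tphi (x := 0)) ?in_itv/= ?ltxx//.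
by case: (x < T / 2); rewrite ?subr0 ?sub0r opprK.
Qed.

Lemma Rintegral_parts phi (x a b : R) : smooth phi -> a <= b ->
  \int[mu]_(y in `]a, b[) ((x - y) * (phi^`())%classic y) =
  (x - b) * phi b - (x - a) * phi a + \int[mu]_(y in `]a, b[) phi y.
Proof.
move=> sphi ab; have cphi := smooth_continuous sphi.
have cdphi := smooth_continuous (smooth_derive1 sphi).
pose F y := (x - y) * phi y.
have dF y : is_derive y (1 : R) F ((x - y) * (phi^`())%classic y - phi y).
  have h1 : is_derive y (1 : R) (fun y : R => x - y) (0 - 1).
    exact: is_deriveB.
  have h2 := is_derive_derive1 (smooth_derivable sphi (x := y)).
  apply: (is_derive_eq (is_deriveM h1 h2)); rewrite /GRing.scale/=; ring.
have cxy : continuous (fun y : R => x - y).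
  by move=> y; apply: cvgB; [exact: cvg_cst|exact: cvg_id].
have cxphi : continuous (fun y => (x - y) * (phi^`())%classic y).
  by move=> y; apply: cvgM; [exact: cxy|exact: cdphi].
have := @Rintegral_oo_derive _ F _ a b ab dF.
rewrite RintegralB//; try exact: continuous_integrable_oo.
rewrite -/(F a) -/(F b) => <-; first by rewrite subrK.
by move=> y; apply: cvgB; [exact: cxphi|exact: cphi].
Qed.

Lemma BV_with_Kfun x : x \in `]0, T[ ->
  BV_with T (Kfun T x) (L1_pairing T (Kderiv x)).
Proof.
move=> xT; split.
- have [c hc] : exists c, forall y, y \in `]0, T[ -> `|Kfun T x y| <= c.
    exists T => y; move: xT; rewrite !in_itv/= => /andP[x0 xT] /andP[y0 yT].
    rewrite /Kfun; case: (x < T / 2); rewrite normrM indicE;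
      case: (_ \in _); rewrite ?normr1 ?normr0 ?mul1r ?mul0r ?(ltW T0)// ler_norml; lra.
  have -> : Kfun T x = fun y => 1 * Kfun T x y.
    by apply/funext => y; rewrite mul1r.
  apply: (mul_bounded_integrable _ _ hc).
    by apply: (@bounded_integrable_oo _ 1) => // y; rewrite normr1.
  by apply: measurable_funTS; exact: Kfun_measurable.
- by apply: in_M_L1 => //; exact: Kderiv_integrable.
move=> phi tphi; have sphi := test_smooth tphi.
rewrite L1_pairing_Kderiv//; last first.
  exact/continuous_integrable_oo/smooth_continuous.
move: xT; rewrite in_itv/= => /andP[x0 xT].
rewrite /L1_pairing /Kfun; case: (x < T / 2); congr (- _) || idtac.
- transitivity (\int[mu]_(y in `]0, T[) (\1_`]0, x[ y * ((x - y) * (phi^`())%classic y))).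
    rewrite (Rintegral_indic_oo _ (lexx 0) (ltW xT)) Rintegral_parts 1?ltW//.
    rewrite (test_outside tphi (x := 0)) ?in_itv/= ?ltxx//.
    by rewrite subrr mul0r mulr0 subrr add0r.
  by apply: eq_Rintegral => y _; rewrite mulrA.
- transitivity (- - \int[mu]_(y in `]x, T[) phi y); first by rewrite opprK.
  congr (- _).
  transitivity (\int[mu]_(y in `]0, T[) (\1_`]x, T[ y * ((x - y) * (phi^`())%classic y * (-1)))).
    rewrite (Rintegral_indic_oo _ (ltW x0) (lexx T)) RintegralZr//.
      rewrite Rintegral_parts 1?ltW//.
      rewrite (test_outside tphi (x := T)) ?in_itv/= ?ltxx ?andbF//.
      by rewrite subrr mul0r mulr0 subrr add0r mulrN1.
    apply: continuous_integrable_oo => y; apply: cvgM.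
      by apply: cvgB; [exact: cvg_cst|exact: cvg_id].
    exact: smooth_continuous (smooth_derive1 sphi) y.
  by apply: eq_Rintegral => y _; ring.
Qed.

Lemma BV_with_affine (c d : R) :
  BV_with T (fun x => c * x + d) (L1_pairing T (cst c)).
Proof.
have ci : mu.-integrable `]0, T[ (EFin \o cst c).
  by apply: (@bounded_integrable_oo _ `|c|).
have caff : continuous (fun x : R => c * x + d).
  by move=> y; apply: cvgD; [apply: cvgM; [exact: cvg_cst|exact: cvg_id]|exact: cvg_cst].
split; first exact: continuous_integrable_oo.
  exact: in_M_L1.
move=> phi tphi; have sphi := test_smooth tphi.
have cphi := smooth_continuous sphi.
have cdphi := smooth_continuous (smooth_derive1 sphi).
rewrite /L1_pairing/= RintegralZl//; last exact: continuous_integrable_oo.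
have := Rintegral_parts 0 sphi (ltW T0).
rewrite !(test_outside tphi) ?in_itv/= ?ltxx ?andbF// !mulr0 subrr add0r => <-.
have := test_Rintegral_derive tphi (ltW T0).
rewrite !(test_outside tphi) ?in_itv/= ?ltxx ?andbF// subrr => h0.
have c0 : continuous (fun y : R => (0 - y) * (phi^`())%classic y).
  by move=> y; apply: cvgM; [apply: cvgB; [exact: cvg_cst|exact: cvg_id]|exact: cdphi].
have i0 := @continuous_integrable_oo _ 0 T c0.
have i1 := @continuous_integrable_oo _ 0 T cdphi.
transitivity (- \int[mu]_(x in `]0, T[)
    (- c * ((0 - x) * (phi^`())%classic x) + d * (phi^`())%classic x)).
  rewrite RintegralD//; last 2 first.
  - rewrite (_ : EFin \o _ = (fun x => (- c)%:E *
      (EFin \o (fun y : R => ((0 - y) * (phi^`())%classic y)%R)) x)%E)//.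
    exact: integrableZl.
  - rewrite (_ : EFin \o _ = (fun x => d%:E * (EFin \o (phi^`())%classic) x)%E)//.
    exact: integrableZl.
  by rewrite !RintegralZl// h0 mulr0 addr0 mulNr opprK.
by congr (- _); apply: eq_Rintegral => y _; ring.
Qed.

End BV.

(** * Extension of distributional identities from test functions to C0 *)

Section duality.
Context {R : realType}.
Variable T : R.
Hypothesis T0 : 0 < T.
Local Notation mu := (@lebesgue_measure R).
Implicit Types (u v w f phi : R -> R) (m n : (R -> R) -> R).

Lemma normr_le_eps (x K : R) : (forall e, 0 < e -> `|x| <= K * e) -> x = 0.
Proof.
move=> h; apply/eqP; rewrite -normr_le0; apply/ler_addgt0Pl => e e0.
have K1 : 0 < `|K| + 1 by rewrite ltr_wpDl.
rewrite addr0; apply: le_trans (h _ (divr_gt0 e0 K1)) _.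
rewrite mulrCA; apply: ler_piMr; first exact: ltW.
rewrite ler_pdivrMr// mul1r.
by rewrite (le_trans (ler_norm _))// lerDl.
Qed.

(** [BV_with] constrains the derivative on test functions only; density and boundedness determine it
    on C0. This is needed because the infimum in [TGV] ranges over all representatives of Du. *)
Lemma BV_with_unique u m n v : BV_with T u m -> BV_with T u n -> C0 T v ->
  m v = n v.
Proof.
move=> [_ hm um] [_ hn un] Cv; apply/eqP; rewrite -subr_eq0; apply/eqP.
apply: (@normr_le_eps _ (normM T m + normM T n)) => e e0.
have [f [a [b [sf a0 ab bT [f0 vf]]]]] := C0_smooth_approx T0 Cv e0.
have tf := test_function_supported sf a0 bT f0.
have Cf := C0_supported (smooth_continuous sf) a0 bT f0.
have Cvf := C0B Cv Cf; have nvf : normC T (fun x => v x - f x) <= e.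
  exact: normC_le.
have -> : m v - n v = m (fun x => v x - f x) - n (fun x => v x - f x).
  by rewrite (in_MB hm)// (in_MB hn)// (um _ tf) (un _ tf); ring.
apply: le_trans (ler_normB _ _) _; rewrite mulrDl; apply: lerD.
  by apply: le_trans (normM_pairing T0 hm Cvf) _; apply: ler_wpM2l => //; exact: normM_ge0.
by apply: le_trans (normM_pairing T0 hn Cvf) _; apply: ler_wpM2l => //; exact: normM_ge0.
Qed.

Lemma Rintegral_oo_bound f (a b c : R) : a <= b ->
  mu.-integrable `]a, b[ (EFin \o f) -> (forall x, x \in `]a, b[ -> `|f x| <= c) ->
  `|\int[mu]_(x in `]a, b[) f x| <= c * (b - a).
Proof.
move=> ab fi fc.
apply: le_trans (le_normr_Rintegral _ fi) _ => //.
have -> : c * (b - a) = \int[mu]_(x in `]a, b[) c.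
  rewrite Rintegral_cst//= lebesgue_measure_itv/= lte_fin.
  by move: ab; rewrite le_eqVlt => /predU1P[->|->]; rewrite ?ltxx ?subrr ?mulr0.
apply: le_Rintegral => //.
- exact: integrable_norm.
- by apply: continuous_integrable_oo => x; exact: cvg_cst.
Qed.

(** A smooth transition from 0 to 1 across the middle third of [0, T]. Its derivative [dchi] has
    integral 1 and compact support in ]0, T[, so that subtracting [s * dchi] removes a mean [s]
    without leaving the test functions. *)
Let chi (x : R) := step (3 / T * x + (-1)).
Let dchi (x : R) := 3 / T * ((primitive flat_bump 1)^-1 * flat_bump (3 / T * x + (-1))).

Let dchiE x : is_derive x (1 : R) chi (dchi x).
Proof.
have h1 : is_derive x (1 : R) (fun x => 3 / T * x + (-1)) (3 / T).
  have := is_deriveD (is_deriveZ (3 / T) (is_derive_id x (1 : R))) (is_derive_cst (-1 : R) x (1:R)).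
  by rewrite addr0 /GRing.scale/= mulr1.
have := @is_derive1_comp _ step (fun y => 3 / T * y + (-1)) x _ _
  (is_derive_step (3 / T * x + (-1))) h1.
by move=> h2; apply: (is_derive_eq h2); exact: mulrC.
Qed.

Let sdchi : smooth dchi.
Proof.
apply: smoothZ; apply: smoothZ; apply: smooth_affine; exact: smooth_flat_bump.
Qed.

Let chi0 x : x <= T / 3 -> chi x = 0.
Proof.
move=> xT; apply: step_eq0; rewrite subr_le0 mulrAC ler_pdivrMr// mul1r.
by rewrite mulrC -ler_pdivlMr.
Qed.

Let chi1 x : 2 * T / 3 <= x -> chi x = 1.
Proof.
move=> xT; apply: step_eq1; rewrite lerBrDr mulrAC ler_pdivlMr//.
by move: xT; rewrite ler_pdivrMr//; lra.
Qed.

Let dchi_out x : x \notin `[T / 3, 2 * T / 3] -> dchi x = 0.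
Proof.
move=> xT; rewrite /dchi flat_bump_eq0 ?mulr0//; apply: contra xT.
rewrite !in_itv/= subr_ge0 lerBlDr mulrAC ler_pdivlMr// ler_pdivrMr//.
by rewrite ler_pdivrMr// ler_pdivlMr//; lra.
Qed.

Variable g : L2 T.
Hypothesis g_affine : forall l, affine l -> dot g l = 0.

Let prim1_integrable (x : R) : x <= T -> mu.-integrable `]0, x[ (EFin \o prim1 g).
Proof.
move=> xT; apply: (@integrableS _ _ _ mu `[0, T]) => //.
  by apply: subset_itvW.
apply: continuous_compact_integrable; first exact: segment_compact.
exact: prim1_within_continuous.
Qed.

Lemma prim1_mean0 : \int[mu]_(s in `]0, T[) prim1 g s = 0.
Proof. have := prim2_T T0 g_affine; rewrite prim2E//; lra. Qed.

(* [- prim1 g] is approximated uniformly by some [psi] smooth with compact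
   support; subtracting a multiple of [dchi] makes its mean 0, hence its
   primitive [phi] a test function, close to [prim2 g]. *)
Lemma BV_with_prim2 w n : BV_with T w n ->
  n (prim2 g) = L1_pairing T w (prim1 g).
Proof.
move=> [wi hn wn]; have Cp := prim1_C0 T0 g_affine; have CP := prim2_C0 T0 g_affine.
have [B B0 hB] := continuous_bounded_itv T0 (smooth_continuous sdchi).
apply/eqP; rewrite -subr_eq0; apply/eqP.
(* Correcting the mean costs at most e T B, so [dphi] is within e (1 + T B) of [- prim1 g];
   integration gives T times this for [prim2 g - phi]. The first factor collects the two pairings in
   which these errors enter. *)
apply: (@normr_le_eps _ ((normM T n * T + normL1 T w) * (1 + T * B))) => e e0.
have CNp : C0 T (fun x => -1 * prim1 g x) by exact: C0Z.
have [psi [a [b [sf a0 ab bT [f0 pf]]]]] := C0_smooth_approx T0 CNp e0.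
have cpsi := smooth_continuous sf.
pose s := \int[mu]_(t in `[a, b]) psi t.
pose phi x := primitive psi x + (- s) * chi x.
pose dphi x := (- s) * dchi x + psi x.
have dphiE x : is_derive x (1 : R) phi (dphi x).
  rewrite /dphi addrC; apply: is_deriveD; first exact: is_derive_primitive sf f0 x.
  exact: is_deriveZ.
have sdphi : smooth dphi by exact: (smoothD (@smoothZ _ (- s) _ sdchi) sf).
have sphi : smooth phi := smooth_primitive dphiE sdphi.
have aT3 : 0 < Num.min a (T / 3) by rewrite lt_min a0 divr_gt0.
have bT3 : Num.max b (2 * T / 3) < T by rewrite gt_max bT/= ltr_pdivrMr//; lra.
have phi0 x : x \notin `[Num.min a (T / 3), Num.max b (2 * T / 3)] -> phi x = 0.
  rewrite in_itv/= negb_and -!ltNge lt_min gt_max => /orP[|] /andP[h1 h2].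
    by rewrite /phi (primitive_eq0 f0)// chi0 ?mulr0 ?addr0// ltW.
  by rewrite /phi (primitive_total f0) ?(ltW h1)// chi1 ?(ltW h2)// mulr1 subrr.
have tphi := test_function_supported sphi aT3 bT3 phi0.
have Cphi := C0_supported (smooth_continuous sphi) aT3 bT3 phi0.
have Cpsi := C0_supported cpsi a0 bT f0.
have Cdchi : C0 T dchi.
  apply: (C0_supported (smooth_continuous sdchi)) dchi_out.
    by rewrite divr_gt0.
  by rewrite ltr_pdivrMr//; lra.
have Cdphi : C0 T dphi by exact: C0_lin.
(* [prim1 g] has mean 0, hence [s] is the integral of the approximation error [prim1 g + psi]. *)
have s_le : `|s| <= e * T.
  have iw : mu.-integrable `]0, T[ (EFin \o (fun x => 1 * prim1 g x + psi x)).
    by apply: integrable_lin; [exact: prim1_integrable|exact: continuous_integrable_oo].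
  have -> : s = \int[mu]_(x in `]0, T[) (1 * prim1 g x + psi x).
    rewrite (_ : (fun x => 1 * prim1 g x + psi x) = fun x => prim1 g x + psi x); last first.
      by apply/funext => x; rewrite mul1r.
    rewrite RintegralD//; last 2 first.
    - exact: prim1_integrable.
    - exact: continuous_integrable_oo.
    rewrite prim1_mean0 add0r.
    rewrite (Rintegral_oo_derive (ltW T0) (is_derive_primitive sf f0) cpsi).
    by rewrite (primitive_eq0 f0 a0) subr0 (primitive_total f0 (ltW bT)).
  rewrite -[X in _ * X]subr0; apply: Rintegral_oo_bound => //; first exact: ltW.
  move=> x xT; rewrite -normrN (_ : - _ = -1 * prim1 g x - psi x); first exact: pf.
  by ring.
have dphi_p x : x \in `]0, T[ -> `|dphi x + prim1 g x| <= e * (1 + T * B).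
  move=> xT; have -> : dphi x + prim1 g x = - (-1 * prim1 g x - psi x) + (- s) * dchi x.
    by rewrite /dphi; ring.
  apply: le_trans (ler_normD _ _) _; rewrite normrN mulrDr mulr1.
  apply: lerD; first exact: pf.
  by rewrite normrM normrN mulrA ler_pM// hB.
have phi_P x : x \in `]0, T[ -> `|prim2 g x - phi x| <= T * (e * (1 + T * B)).
  rewrite in_itv/= => /andP[x0 xT].
  have phi00 : phi 0 = 0 by apply: phi0; rewrite in_itv/= leNgt aT3.
  have dphi_int : \int[mu]_(y in `]0, x[) dphi y = phi x.
    rewrite (Rintegral_oo_derive (ltW x0) dphiE) ?phi00 ?subr0//.
    exact: smooth_continuous.
  have -> : prim2 g x - phi x = - \int[mu]_(y in `]0, x[) (dphi y + prim1 g y).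
    rewrite RintegralD//; last 2 first.
    - exact/continuous_integrable_oo/smooth_continuous.
    - by apply: prim1_integrable; exact: ltW.
    by rewrite dphi_int prim2E ?(ltW xT)//; ring.
  rewrite normrN; apply: le_trans (_ : e * (1 + T * B) * (x - 0) <= _).
    apply: Rintegral_oo_bound; first exact: ltW.
      rewrite (_ : EFin \o _ = (EFin \o dphi) \+ (EFin \o prim1 g))%E//.
      apply: integrableD => //.
        exact/continuous_integrable_oo/smooth_continuous.
      by apply: prim1_integrable; exact: ltW.
    move=> y; rewrite in_itv/= => /andP[y0 yx]; apply: dphi_p.
    by rewrite in_itv/= y0 (lt_trans yx).
  rewrite subr0 mulrC ler_wpM2r// ?(ltW xT)//.
  by rewrite mulr_ge0 ?(ltW e0)// addr_ge0// mulr_ge0// ltW.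
have CPphi := C0B CP Cphi.
have e1 : 0 <= e * (1 + T * B).
  by rewrite mulr_ge0 ?(ltW e0)// addr_ge0// mulr_ge0// ltW.
(* [n phi] is minus the pairing of [w] with [dphi] because [phi] is a test function; only the two
   approximation errors remain. *)
have -> : n (prim2 g) - L1_pairing T w (prim1 g) =
    n (fun x => prim2 g x - phi x) - L1_pairing T w (fun x => 1 * dphi x + prim1 g x).
  rewrite (in_MB hn)// (wn _ tphi) (in_M_lin 1 (in_M_L1 T0 wi))// (derive1_ext dphiE).
  by ring.
apply: le_trans (ler_normB _ _) _.
have -> : (normM T n * T + normL1 T w) * (1 + T * B) * e =
   normM T n * (T * (e * (1 + T * B))) + normL1 T w * (e * (1 + T * B)) by ring.
apply: lerD.
  apply: le_trans (normM_pairing T0 hn CPphi) _; apply: ler_wpM2l.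
    exact: normM_ge0.
  exact: normC_le.
apply: L1_pairing_bound => //.
  exact: C0_measurable (C0_lin 1 Cdphi Cp).
by move=> x xT; rewrite mul1r; exact: dphi_p.
Qed.

End duality.

(** * Bounds on TGV *)

Lemma inf_nonneg {R : realType} (S : set R) :
  (forall x, S x -> 0 <= x) -> 0 <= inf S.
Proof.
move=> S0; have [[S1 _]|/inf_out ->//] := pselect (has_inf S).
exact: lb_le_inf.
Qed.

Section TGV_bounds.
Context {R : realType}.
Variables T alpha beta : R.
Hypotheses (T0 : 0 < T) (alpha0 : 0 < alpha) (beta0 : 0 < beta).
Local Notation mu := (@lebesgue_measure R).
Implicit Types (v : L2 T) (m n : (R -> R) -> R) (w : R -> R).

(* A competitor in the infimal formula for [TGV v], of cost at most [t], whose
   derivative [m] of [v] is explicit enough to be evaluated at [prim1 g]. *)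
Definition TGV_cert v (t : R) := exists m w n,
  [/\ BV_with T v m, BV_with T w n,
      alpha * normM T (fun f => m f - L1_pairing T w f) + beta * normM T n <= t
    & forall g, (forall l, affine l -> dot g l = 0) -> m (prim1 g) = - dot g v].

Lemma normM_ext m n : (forall f, C0 T f -> m f = n f) -> normM T m = normM T n.
Proof.
move=> mn; congr sup; apply/seteqP; split=> _ [f [Cf f1] <-];
  by exists f; rewrite ?mn.
Qed.

Lemma in_M_sub_L1 u m w n : BV_with T u m -> BV_with T w n ->
  in_M T (fun f => m f - L1_pairing T w f).
Proof.
move=> [_ hm _] [wi _ _].
have := in_M_comb T0 (-1) (in_M_L1 T0 wi) hm.
by under [X in in_M _ X -> _]eq_fun do rewrite mulN1r addrC.
Qed.

Lemma TGV_cert_lin (a : R) v1 v2 (t1 t2 : R) : TGV_cert v1 t1 -> TGV_cert v2 t2 ->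
  TGV_cert (a *: v1 + v2) (`|a| * t1 + t2).
Proof.
move=> [m1 [w1 [n1 [vm1 wn1 c1 p1]]]] [m2 [w2 [n2 [vm2 wn2 c2 p2]]]].
exists (fun f => a * m1 f + m2 f), (fun x => a * w1 x + w2 x),
  (fun f => a * n1 f + n2 f); split.
- apply: BV_with_ae (BV_with_lin T0 a vm1 vm2).
  + apply: measurable_funD; last exact: L2_measurable.
    by apply: measurable_funM => //; exact: L2_measurable.
  + exact: L2_measurable.
  + by apply: filterS2 (L2_addE (a *: v1) v2) (L2_scaleE a v1) => x -> ->.
- exact: BV_with_lin.
- have hm1 := in_M_sub_L1 vm1 wn1; have hm2 := in_M_sub_L1 vm2 wn2.
  rewrite (@normM_ext _ (fun f => a * (m1 f - L1_pairing T w1 f) +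
                                  (m2 f - L1_pairing T w2 f))); last first.
    move=> f Cf; case: wn1 => w1i _ _; case: wn2 => w2i _ _.
    have [c _ hc] := C0_bounded T0 Cf.
    rewrite (L1_pairing_lin _ w1i w2i (C0_measurable Cf) hc).
    by ring.
  have n12 : normM T (fun f => a * n1 f + n2 f) <= `|a| * normM T n1 + normM T n2.
    by apply: normM_comb => //; [case: wn1|case: wn2].
  have m12 := normM_comb T0 a hm1 hm2.
  apply: le_trans (lerD (ler_wpM2l (ltW alpha0) m12) (ler_wpM2l (ltW beta0) n12)) _.
  apply: le_trans (lerD (ler_wpM2l (normr_ge0 a) c1) c2).
  by rewrite le_eqVlt; apply/orP; left; apply/eqP; ring.
- by move=> g hg; rewrite (p1 g hg) (p2 g hg) dotDZr; ring.
Qed.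

Lemma L1_pairing_cst0 f : L1_pairing T (cst 0) f = 0 :> R.
Proof.
rewrite /L1_pairing (@eq_Rintegral _ _ _ _ _ (cst 0)).
  by rewrite Rintegral_cst// mul0r.
by move=> x _; rewrite /= mul0r.
Qed.

Lemma TGV_cert0 : TGV_cert 0 0.
Proof.
exists (cst 0), (cst 0), (cst 0); split.
- apply: BV_with_ae (BV_with_cst T0 0) => //; first exact: L2_measurable.
  apply: filterS (L2classE (0 : LfunType (leb0T T) (@lee1n R 2))) => x.
  by move=> ->.
- exact: BV_with_cst.
- rewrite (@normM_ext _ (cst 0)) ?normM_cst0 ?mulr0 ?addr0// => f _.
  by rewrite L1_pairing_cst0 subr0.
- by move=> g hg; rewrite dot0r oppr0.
Qed.

Lemma TGV_certZ (a : R) v (t : R) : TGV_cert v t -> TGV_cert (a *: v) (`|a| * t).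
Proof. by move=> vt; have := TGV_cert_lin a vt TGV_cert0; rewrite !addr0. Qed.

Lemma TGV_cert_le v (s t : R) : s <= t -> TGV_cert v s -> TGV_cert v t.
Proof.
move=> st [m [w [n [h1 h2 h3 h4]]]]; exists m, w, n; split=> //.
exact: le_trans st.
Qed.

(** With [w = 0] the whole cost is alpha times the norm of the Dirac mass at x, whence the scaling
    of S_x in [ExtB]. *)
Lemma TGV_cert_SL2 (x : R) : x \in `]0, T[ -> TGV_cert (SL2 T x) alpha.
Proof.
move=> xT; exists (fun f => f x), (cst 0), (cst 0); split.
- apply: BV_with_ae (BV_with_Sfun T0 xT).
  + exact: Sfun_measurable.
  + exact: L2_measurable.
  + by apply: filterS (L2classE (Lfun_Sub (lee1n 2) (Sfun_Lfun T x))) => y ->.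
- exact: BV_with_cst.
- rewrite (@normM_ext _ (fun f => f x)); last first.
    by move=> f _; rewrite L1_pairing_cst0 subr0.
  by rewrite normM_cst0// mulr0 addr0 ger_pMr// normM_dirac.
- by move=> g hg; rewrite dot_SL2// opprK.
Qed.

(** Taking for [w] the derivative of K_x cancels the first term and leaves beta times the norm of a
    Dirac mass. The value at [prim1 g] comes from integration by parts against [prim2 g]. *)
Lemma TGV_cert_KL2 (x : R) : x \in `]0, T[ -> TGV_cert (KL2 T x) beta.
Proof.
move=> xT; exists (L1_pairing T (Kderiv T x)), (Kderiv T x), (fun f => f x); split.
- apply: BV_with_ae (BV_with_Kfun T0 xT).
  + exact: Kfun_measurable.
  + exact: L2_measurable.
  + by apply: filterS (L2classE (Lfun_Sub (lee1n 2) (Kfun_Lfun T x))) => y ->.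
- exact: BV_with_Kderiv.
- rewrite (@normM_ext _ (cst 0)); last by move=> f _; rewrite subrr.
  by rewrite normM_cst0// mulr0 add0r ger_pMr// normM_dirac.
- move=> g hg; rewrite dot_KL2// opprK -(BV_with_prim2 T0 hg (BV_with_Kderiv T0 xT)).
  by [].
Qed.

Lemma TGV_cert_affine (l : L2 T) : affine l -> TGV_cert l 0.
Proof.
move=> [c [d lE]]; exists (L1_pairing T (cst c)), (cst c), (cst 0); split.
- rewrite lE; apply: BV_with_ae (BV_with_affine T0 c d).
  + exact: affine_measurable.
  + exact: L2_measurable.
  + by apply: filterS (L2classE (Lfun_Sub (lee1n 2) (affine_Lfun T c d))) => y ->.
- exact: BV_with_cst.
- rewrite (@normM_ext _ (cst 0)); last by move=> f _; rewrite subrr.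
  by rewrite !normM_cst0// !mulr0 addr0.
- move=> g hg; rewrite hg; last by exists c, d.
  rewrite -(BV_with_prim2 T0 hg (BV_with_cst T0 c)) /=.
  by rewrite oppr0.
Qed.

Lemma TGV_cert_sum (s : seq (L2 T)) (lam : L2 T -> R) :
  (forall v, v \in s -> 0 <= lam v /\ TGV_cert v 1) ->
  TGV_cert (\sum_(v <- s) lam v *: v) (\sum_(v <- s) lam v).
Proof.
elim: s => [|v s IH] hs; first by rewrite !big_nil; exact: TGV_cert0.
have [lv vc] := hs v (mem_head _ _).
rewrite !big_cons -{2}[lam v]mulr1 -{2}(ger0_norm lv).
by apply: TGV_cert_lin => //; apply: IH => w ws; apply: hs; rewrite in_cons ws orbT.
Qed.

Lemma TGV_ge0 (u : R -> R) : 0 <= TGV T alpha beta u.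
Proof.
apply: inf_nonneg => _ [w [m [n [_ _ ->]]]].
by rewrite addr_ge0// mulr_ge0 ?normM_ge0// ltW.
Qed.

Lemma TGV_le v (t : R) : TGV_cert v t -> TGV T alpha beta v <= t.
Proof.
move=> [m [w [n [vm wn c _]]]]; apply: le_trans c.
apply: ge_inf; last by exists w, m, n.
exists 0 => _ [w' [m' [n' [_ _ ->]]]].
by rewrite addr_ge0// mulr_ge0 ?normM_ge0// ltW.
Qed.

Lemma TGV_cert_BV v (t : R) : TGV_cert v t -> BV T v.
Proof. by move=> [m [w [n [vm _ _ _]]]]; exists m. Qed.

(* Weak duality: [prim2 g / M] is admissible in the predual problem defining
   TGV, and its second derivative is [- g / M]. *)
Lemma dot_le_TGV v (t M : R) (g : L2 T) : TGV_cert v t ->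
  (forall l, affine l -> dot g l = 0) -> 0 < M ->
  normC T (prim1 g) <= M * alpha -> normC T (prim2 g) <= M * beta ->
  - dot g v <= M * TGV T alpha beta v.
Proof.
move=> [m0 [w0 [n0 [vm0 wn0 _ p0]]]] hg M0 g1 g2.
rewrite -ler_pdivrMl//; apply: lb_le_inf.
  by exists (alpha * normM T (fun f => m0 f - L1_pairing T w0 f) + beta * normM T n0), w0, m0, n0.
move=> _ [w [m [n [vm wn ->]]]]; rewrite ler_pdivrMl//.
have Cp := prim1_C0 T0 hg; have CP := prim2_C0 T0 hg.
rewrite -(p0 g hg) (BV_with_unique T0 vm0 vm Cp).
(* The pairing of [w] with [prim1 g] equals [n (prim2 g)]; inserting it splits the value into the
   two terms weighted by alpha and beta. *)
have -> : m (prim1 g) = (m (prim1 g) - L1_pairing T w (prim1 g)) + n (prim2 g).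
  by rewrite (BV_with_prim2 T0 hg wn) subrK.
have h1 := normM_pairing T0 (in_M_sub_L1 vm wn) Cp.
have hn : in_M T n by case: wn.
have h2 := normM_pairing T0 hn CP.
have k1 := ler_wpM2l (normM_ge0 T (fun f => m f - L1_pairing T w f)) g1.
have k2 := ler_wpM2l (normM_ge0 T n) g2.
apply: le_trans (ler_norm _) _; apply: le_trans (ler_normD _ _) _.
apply: le_trans (lerD (le_trans h1 k1) (le_trans h2 k2)) _.
by rewrite le_eqVlt; apply/orP; left; apply/eqP; ring.
Qed.

End TGV_bounds.

(** * Optimality conditions and descent *)

Section smooth_functional.
Context {R : realType}.
Variables (T : R) (f : L2 T -> R) (grad : L2 T -> L2 T).
Hypothesis fgrad : is_gradient f grad.

Lemma is_derive_line (u d : L2 T) (t : R) :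
  is_derive t 1 (fun s : R => f (u + s *: d)) (dot (grad (u + t *: d)) d).
Proof.
have [fd fE] := fgrad (u + t *: d).
have E : (fun h : R => h^-1 *:
      (((fun s : R => f (u + s *: d)) \o shift t) (h *: (1 : R)) - f (u + t *: d))) =
    (fun h : R => h^-1 *: ((f \o shift (u + t *: d)) (h *: d) - f (u + t *: d))).
  apply/funext => h; congr (_ *: (_ - _)); rewrite /=; congr f.
  have -> : h *: (1 : R) = h by exact: mulr1.
  by rewrite scalerDl addrCA.
have dd : derivable f (u + t *: d) d by exact: diff_derivable.
apply: DeriveDef.
  by rewrite /derivable E; exact: dd.
by rewrite /derive E -fE -deriveE.
Qed.

Variable Lf : R.
Hypothesis lip : forall u v, `|grad u - grad v| <= Lf * `|u - v|.

(** Instead of integrating the gradient along the segment, the difference [K] between f and its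
    quadratic majorant is shown to be nonincreasing on [0, 1]. *)
Lemma descent (u d : L2 T) :
  f (u + d) <= f u + dot (grad u) d + Lf / 2 * `|d| ^+ 2.
Proof.
pose K (t : R) := f (u + t *: d) - (dot (grad u) d * t + Lf / 2 * `|d| ^+ 2 * (t * t)).
have dK (t : R) : is_derive t (1 : R) K (dot (grad (u + t *: d)) d -
     (dot (grad u) d + Lf * `|d| ^+ 2 * t)).
  have h1 := is_derive_line u d t.
  have h2 := is_deriveZ (dot (grad u) d) (is_derive_id t (1 : R)).
  have did := is_derive_id t (1 : R).
  have h3 := is_deriveZ (Lf / 2 * `|d| ^+ 2) (is_deriveM did did).
  apply: (is_derive_eq (is_deriveB h1 (is_deriveD h2 h3))).
  by rewrite /GRing.scale/=; field.
have K10 : K 1 <= K 0.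
  apply: (@ler0_derive1_nincr _ K 0 1); rewrite ?ler01 ?lexx//.
  - move=> t; rewrite in_itv/= => /andP[t0 _].
    rewrite (derive1_ext dK) opprD addrA -dotBl subr_le0.
    apply: le_trans (ler_norm _) _; apply: le_trans (dot_norm _ _) _.
    apply: le_trans (ler_wpM2r (normr_ge0 d) (lip _ _)) _.
    by rewrite addrC addKr normrZ (gtr0_norm t0) expr2; lra.
  - apply: continuous_subspaceT => t; apply: differentiable_continuous.
    by apply/derivable1_diffP; exact: ex_derive.
move: K10; rewrite /K !scale1r scale0r addr0 !mulr0 !mulr1 addr0 subr0; lra.
Qed.

(** The term [c * t] is the change of total weight along [d]: [c = 0] for affine directions, [c = 1]
    when one weight moves. In the latter case [e] is the room before that weight becomes negative,
    so 0 is an interior minimum. *)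
Lemma stationary (u d : L2 T) (c e : R) : 0 < e ->
  (forall t, `|t| < e -> f u <= f (u + t *: d) + c * t) -> dot (grad u) d = - c.
Proof.
move=> e0 hmin; pose K (t : R) := f (u + t *: d) + c * t.
have dK (t : R) : is_derive t (1 : R) K (dot (grad (u + t *: d)) d + c).
  have h2 := is_deriveZ c (is_derive_id t (1 : R)).
  apply: (is_derive_eq (is_deriveD (is_derive_line u d t) h2)).
  by rewrite /GRing.scale/= mulr1.
have e00 : (0 : R) \in `](- e), e[ by rewrite in_itv/= e0 oppr_lt0 e0.
have eN : - e < e by lra.
have h : is_derive (0 : R) (1 : R) K 0.
  apply: (derive1_at_min (ltW eN)) e00 _ => t.
    by move=> _; exact: ex_derive.
  rewrite in_itv/= => te; rewrite {1}/K scale0r addr0 mulr0 addr0; apply: hmin.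
  by rewrite ltr_norml.
have := @derive_val _ _ _ _ _ _ _ h; rewrite (@derive_val _ _ _ _ _ _ _ (dK 0)).
by rewrite scale0r addr0; lra.
Qed.

End smooth_functional.

Section iterates.
Context {R : realType}.
Variables (T alpha beta : R).
Hypotheses (T0 : 0 < T) (alpha0 : 0 < alpha) (beta0 : 0 < beta).
Variables (f : L2 T -> R) (grad : L2 T -> L2 T).
Hypothesis fgrad : is_gradient f grad.
Implicit Types (A B : {fset L2 T}) (lam : L2 T -> R).

Lemma affine0 : affine (0 : L2 T).
Proof.
exists 0, 0; apply/L2_ae_eqP.
apply: filterS2 (L2classE (0 : LfunType (leb0T T) (@lee1n R 2)))
  (L2classE (Lfun_Sub (lee1n 2) (affine_Lfun T 0 0))) => x -> ->.
by rewrite /= mul0r addr0.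
Qed.

Lemma affine_lin (a : R) (l1 l2 : L2 T) : affine l1 -> affine l2 -> affine (a *: l1 + l2).
Proof.
move=> [c1 [d1 ->]] [c2 [d2 ->]]; exists (a * c1 + c2), (a * d1 + d2).
set k1 := L2class _; set k2 := L2class _.
apply/L2_ae_eqP.
apply: filterS3 (filterI (L2_addE (a *: k1) k2) (L2_scaleE a k1))
  (filterI (L2classE (Lfun_Sub (lee1n 2) (affine_Lfun T c1 d1)))
           (L2classE (Lfun_Sub (lee1n 2) (affine_Lfun T c2 d2))))
  (L2classE (Lfun_Sub (lee1n 2) (affine_Lfun T (a * c1 + c2) (a * d1 + d2)))).
move=> x [h1 h2] [h3 h4] h5; rewrite h1 h2 h5 /k1 /k2 h3 h4 /=; ring.
Qed.

Lemma prune_sum (V : zmodType) A lam (F : L2 T -> V) :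
  (forall v, lam v = 0 -> F v = 0) ->
  \sum_(v <- [fset v in A | lam v != 0]%fset) F v = \sum_(v <- A) F v.
Proof.
move=> F0; rewrite -big_fset_condE big_mkcond; apply: eq_bigr => v _.
by case: ifPn => //; rewrite negbK => /eqP /F0.
Qed.

Lemma combination_prune A lam l :
  combination [fset v in A | lam v != 0]%fset lam l = combination A lam l.
Proof. by rewrite /combination prune_sum// => v ->; rewrite scale0r. Qed.

Lemma weight_prune A lam : weight [fset v in A | lam v != 0]%fset lam = weight A lam.
Proof. by rewrite /weight prune_sum. Qed.

(* [B] is the active set before pruning. *)
Definition optimal A lam l (u : L2 T) :=
  exists2 B, solve_prune f B lam l u A & u = combination A lam l.

Lemma optimal_solve_prune B A lam l u : solve_prune f B lam l u A -> optimal A lam l u.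
Proof.
by move=> h; exists B => //; case: h => _ -> ->; rewrite combination_prune.
Qed.

Lemma optimal_gt0 A lam l u v : optimal A lam l u -> v \in A -> 0 < lam v.
Proof.
move=> [B [[lam0 _ _] _ ->]] _; rewrite !inE => /andP[vB lv].
by rewrite lt_def lv lam0.
Qed.

(** Pruning preserves optimality: a competitor on [A] extends by zero weights to the unpruned set
    [B], with the same combination and the same total weight. *)
Lemma optimal_le A lam l u lam' l' : optimal A lam l u ->
  (forall v, v \in A -> 0 <= lam' v) -> affine l' ->
  f u + weight A lam <= f (combination A lam' l') + weight A lam'.
Proof.
move=> [B [[lam0 al hmin] uE AE] _] lam'0 al'.
pose lam2 v := if v \in A then lam' v else 0.
have := hmin lam2 l'; rewrite -uE -weight_prune -AE.
have AB : (A `<=` B)%fset.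
  by apply/fsubsetP => v; rewrite AE !inE => /andP[].
have -> : combination B lam2 l' = combination A lam' l'.
  rewrite /combination -(big_fset_incl _ AB); last first.
    by move=> v _ /negbTE vA; rewrite /lam2 vA scale0r.
  by congr (_ + _); apply: eq_big_seq => v vA; rewrite /lam2 vA.
have -> : weight B lam2 = weight A lam'.
  rewrite /weight -(big_fset_incl _ AB); last first.
    by move=> v _ /negbTE vA; rewrite /lam2 vA.
  by apply: eq_big_seq => v vA; rewrite /lam2 vA.
apply=> // v vB; rewrite /lam2; case: ifP => // vA; exact: lam'0.
Qed.

Lemma optimal_dot_affine A lam l u k : optimal A lam l u -> affine k ->
  dot (grad u) k = 0.
Proof.
move=> opt ak; rewrite -oppr0.
apply: (stationary fgrad ltr01) => t _; rewrite mul0r addr0.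
have uE : u = combination A lam l by case: opt.
have al : affine l by case: opt => B [[]].
have := optimal_le (lam' := lam) (l' := t *: k + l) opt.
rewrite lerD2r => h; apply: le_trans (h _ _) _.
- by move=> v vA; apply/ltW/(optimal_gt0 opt).
- exact: affine_lin.
by rewrite uE /combination addrCA addrC.
Qed.

(** After pruning the weight of [v] is positive and can move in both directions, which yields an
    equality instead of a one-sided condition. *)
Lemma optimal_dot A lam l u v : optimal A lam l u -> v \in A ->
  dot (grad u) v = -1.
Proof.
move=> opt vA; have lv := optimal_gt0 opt vA.
have uE : u = combination A lam l by case: opt.
have al : affine l by case: opt => B [[]].
apply: (stationary fgrad lv) => t tl; rewrite mul1r.
pose lam' w := lam w + (if w == v then t else 0).
have one (V : zmodType) (x : V) : \sum_(w <- A) (if w == v then x else 0) = x.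
  rewrite (big_fsetD1 v)//= eqxx big1_fset ?addr0// => w; rewrite !inE => /andP[/negbTE -> //].
have := optimal_le (lam' := lam') (l' := l) opt.
have -> : combination A lam' l = u + t *: v.
  rewrite uE /combination addrAC; congr (_ + _).
  under eq_bigr do rewrite scalerDl.
  rewrite big_split/=; congr (_ + _); rewrite -[RHS]one.
  by apply: eq_bigr => w _; case: eqP => [->|]; rewrite ?scale0r.
have -> : weight A lam' = weight A lam + t.
  by rewrite /weight big_split/= one.
rewrite (addrC (weight _ _)) addrA lerD2r; apply => // w wA.
rewrite /lam'; case: eqP => [->|_]; last by rewrite addr0 ltW// (optimal_gt0 opt).
by move: tl; rewrite ltr_norml => /andP[h _]; rewrite -lerBlDl sub0r ltW.
Qed.

Lemma optimal_dot_self A lam l u : optimal A lam l u ->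
  dot (grad u) u = - weight A lam.
Proof.
move=> opt; have uE : u = combination A lam l by case: opt.
have al : affine l by case: opt => B [[]].
rewrite {2}uE /combination dotDr (optimal_dot_affine opt al) addr0 dot_sumr.
rewrite /weight -sumrN; apply: eq_big_seq => v vA.
by rewrite dotZr (optimal_dot opt vA) mulrN1.
Qed.

(** Comparison with zero weights and zero affine part; combined with the lower bound on f, it bounds
    the total weight by M0. *)
Lemma optimal_f0 A lam l u : optimal A lam l u -> f u + weight A lam <= f 0.
Proof.
move=> opt; have := optimal_le (lam' := fun=> 0) (l' := 0) opt.
have -> : combination A (fun=> 0) 0 = 0 :> L2 T.
  by rewrite /combination addr0 big1// => v _; rewrite scale0r.
have -> : weight A (fun=> 0) = 0 by rewrite /weight big1.
by rewrite addr0; apply => //; exact: affine0.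
Qed.

Lemma optimal_cert A lam l u : optimal A lam l u ->
  (forall v, v \in A -> TGV_cert alpha beta v 1) ->
  TGV_cert alpha beta u (weight A lam).
Proof.
move=> opt hA; have uE : u = combination A lam l by case: opt.
have al : affine l by case: opt => B [[]].
rewrite uE /combination -(scale1r (\sum_(v <- A) _)).
rewrite -[weight A lam]addr0 -[weight A lam]mul1r -{2}(normr1 R).
apply: TGV_cert_lin => //; last exact: TGV_cert_affine.
apply: TGV_cert_sum => // v vA; split; last exact: hA.
exact/ltW/(optimal_gt0 opt).
Qed.

Lemma ExtB_cert (v : L2 T) : ExtB alpha beta v -> TGV_cert alpha beta v 1.
Proof.
have S1 (x : R) : x \in `]0, T[ -> TGV_cert alpha beta (alpha^-1 *: SL2 T x) 1.
  move=> xT; rewrite -(mulVf (lt0r_neq0 alpha0)).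
  have a0 : 0 <= alpha^-1 by rewrite invr_ge0 ltW.
  by rewrite -{2}(ger0_norm a0); apply: TGV_certZ => //; exact: TGV_cert_SL2.
have K1 (x : R) : x \in `]0, T[ -> TGV_cert alpha beta (beta^-1 *: KL2 T x) 1.
  move=> xT; rewrite -(mulVf (lt0r_neq0 beta0)).
  have a0 : 0 <= beta^-1 by rewrite invr_ge0 ltW.
  by rewrite -{2}(ger0_norm a0); apply: TGV_certZ => //; exact: TGV_cert_KL2.
have N1 (v' : L2 T) : TGV_cert alpha beta v' 1 -> TGV_cert alpha beta (- v') 1.
  move=> h; rewrite -scaleN1r -[1 in X in TGV_cert _ _ _ X]mulr1.
  by have := TGV_certZ T0 alpha0 beta0 (-1) h; rewrite normrN normr1.
move=> [[x xT [->|->]]|[x xT [->|->]]].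
- exact: S1.
- exact/N1/S1.
- apply: K1; move: xT; rewrite !in_itv/= => /andP[h1 h2].
  have r0 : 0 < beta / alpha by rewrite divr_gt0.
  by apply/andP; split; lra.
- apply/N1/K1; move: xT; rewrite !in_itv/= => /andP[h1 h2].
  have r0 : 0 < beta / alpha by rewrite divr_gt0.
  by apply/andP; split; lra.
Qed.

End iterates.

Section min_upto.
Context {R : realType}.
Implicit Types (F : nat -> R) (c : R).

Lemma min_upto_le F k j : (0 < j <= k)%N -> min_upto F k <= F j.
Proof.
move=> jk; have : j \in index_iota 1 k.+1 by rewrite mem_index_iota ltnS.
rewrite /min_upto; elim: (index_iota _ _) => // i s IH.
rewrite in_cons big_cons ge_min => /predU1P[->|/IH ->]; first by rewrite lexx.
by rewrite orbT.
Qed.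

Lemma le_min_upto F k c : (0 < k)%N ->
  (forall j, (0 < j <= k)%N -> c <= F j) -> c <= min_upto F k.
Proof.
move=> k0 cF; rewrite /min_upto big_seq; apply: (big_ind (fun x => c <= x)) => [|x y cx cy|j].
(* The default value of the iterated minimum is [F 1], a genuine candidate because [0 < k]. *)
- by apply: cF; rewrite k0.
- by rewrite le_min cx.
- by rewrite mem_index_iota ltnS; exact: cF.
Qed.

End min_upto.

Section new_point.
Context {R : realType}.
Variables (T alpha beta : R).
Hypotheses (T0 : 0 < T) (alpha0 : 0 < alpha) (beta0 : 0 < beta).
Implicit Types (g : L2 T) (xS xK : R).

Lemma new_point_cert g xS xK : xS \in `]0, T[ -> xK \in `]0, T[ ->
  TGV_cert alpha beta (new_point alpha beta g xS xK) 1.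
Proof.
have le1 (x c : R) : 0 < c -> `|Num.sg x / c| * c <= 1.
  move=> c0; rewrite normrM normfV (gtr0_norm c0) divfK ?gt_eqF// normr_sg.
  by case: (x != 0).
move=> hS hK; rewrite /new_point; case: ifP => _.
  apply: TGV_cert_le (le1 _ _ alpha0) _; apply: TGV_certZ => //.
  exact: TGV_cert_SL2.
apply: TGV_cert_le (le1 _ _ beta0) _; apply: TGV_certZ => //.
exact: TGV_cert_KL2.
Qed.

(** The sign and the comparison of ratios in [new_point] make the pairing as negative as it can be
    among all S_x / alpha and K_x / beta, up to sign. *)
Lemma dot_new_point g xS xK : (forall l, affine l -> dot g l = 0) ->
  xS \in `]0, T[ -> `|prim1 g xS| = normC T (prim1 g) ->
  xK \in `]0, T[ -> `|prim2 g xK| = normC T (prim2 g) ->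
  dot g (new_point alpha beta g xS xK) =
  - Num.max (normC T (prim1 g) / alpha) (normC T (prim2 g) / beta).
Proof.
move=> hg hS pS hK pK; rewrite /new_point; case: ifPn => h.
  rewrite (max_idPl h) dotZr dot_SL2// -pS normrEsg; ring.
rewrite -ltNge in h.
rewrite (max_idPr (ltW h)) dotZr dot_KL2// -pK normrEsg; ring.
Qed.

End new_point.

Lemma decrease_sqr {R : realFieldType} (a b psi c : R) : 0 < c -> 0 <= psi ->
  (forall t, 0 <= t -> b <= a - t * psi + c / 2 * t ^+ 2) ->
  psi ^+ 2 <= 2 * c * (a - b).
Proof.
(* [psi / c] minimizes the quadratic bound over [t]. *)
move=> c0 p0 /(_ (psi / c)); rewrite divr_ge0 ?(ltW c0)// => /(_ isT) h.
have {h} h : b <= a - psi ^+ 2 / (2 * c).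
  apply: le_trans h _; rewrite le_eqVlt; apply/orP; left; apply/eqP; field.
  by rewrite gt_eqF.
by rewrite mulrC -ler_pdivrMr ?mulr_gt0//; lra.
Qed.

(** * Decrease of the objective along a run, and the gap to TGV *)

Section run.
Context {R : realType}.
Variables (T alpha beta : R).
Hypotheses (T0 : 0 < T) (alpha0 : 0 < alpha) (beta0 : 0 < beta).
Variables (f : L2 T -> R) (grad : L2 T -> L2 T).
Hypothesis fgrad : is_gradient f grad.
Variables (Lf Cf C : R).
Hypothesis Lf0 : 0 < Lf.
Hypothesis lip : forall u v, `|grad u - grad v| <= Lf * `|u - v|.
Hypothesis f_ge : forall u, - Cf <= f u.
Variables (A : nat -> {fset L2 T}) (lam : nat -> L2 T -> R).
Variables (l u uhat : nat -> L2 T) (xS xK : nat -> R).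
Hypothesis hrun : infinite_run alpha beta f grad A lam l u uhat xS xK.
Hypothesis C0 : 0 < C.
Hypothesis hbound : forall k, (0 < k)%N -> (f 0 + Cf) * `|uhat k| <= C.

Local Notation M0 := (f 0 + Cf).
Local Notation g k := (grad (u k)).
Local Notation wt k := (weight (A k) (lam k)).
Local Notation mx k := (Num.max (normC T (prim1 (g k)) / alpha)
                                (normC T (prim2 (g k)) / beta)).

Lemma run_optimal j : (0 < j)%N -> optimal f (A j) (lam j) (l j) (u j).
Proof.
case: j => // -[|j] _; first exact: optimal_solve_prune (run_first hrun).
exact: optimal_solve_prune (run_step hrun _).
Qed.

Lemma run_affine j : (0 < j)%N -> forall l, affine l -> dot (g j) l = 0.
Proof. by move=> j0 k'; exact: (optimal_dot_affine fgrad (run_optimal j0)). Qed.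

Lemma run_uhat_cert j : (0 < j)%N -> TGV_cert alpha beta (uhat j) 1.
Proof.
move=> j0; rewrite (run_new_point hrun j0).
apply: new_point_cert => //; [exact: (run_xS hrun j0).1|exact: (run_xK hrun j0).1].
Qed.

(** The invariant is a competitor of cost at most 1 rather than membership in [ExtB]: it survives
    the insertion of [uhat k] without locating [xK k] inside the narrower interval required
    there. *)
Lemma run_cert j v : v \in A j -> TGV_cert alpha beta v 1.
Proof.
elim: j v => [|[|j] IH] v; first by move=> /(run_input hrun); exact: ExtB_cert.
  have [_ _ ->] := run_first hrun; rewrite !inE => /andP[vA _]; exact: IH.
have [_ _ ->] := run_step hrun (ltn0Sn j); rewrite !inE => /andP[/orP[/eqP ->|vA] _].
  exact: run_uhat_cert.
exact: IH.
Qed.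

Lemma run_mx_gt1 j : (0 < j)%N -> 1 < mx j.
Proof.
move=> j0; rewrite ltNge ge_max; apply/negP => /andP[h1 h2].
by apply: (run_continues hrun j0); rewrite -[alpha]mul1r -[beta]mul1r -!ler_pdivrMr.
Qed.

Lemma run_dot_uhat j : (0 < j)%N -> dot (g j) (uhat j) = - mx j.
Proof.
move=> j0; rewrite (run_new_point hrun j0).
have [hS pS] := run_xS hrun j0; have [hK pK] := run_xK hrun j0.
by apply: dot_new_point => //; exact: run_affine.
Qed.

Lemma run_decrease j t : (0 < j)%N -> 0 <= t ->
  f (u j.+1) + wt j.+1 <=
  f (u j) + wt j - t * (M0 * (mx j - 1)) + Lf * C ^+ 2 / 2 * t ^+ 2.
Proof.
move=> j0 t0; have opt := run_optimal j0.
have M00 : 0 <= M0 by have := f_ge 0; lra.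
(* The gradient pairs to -1 with every active element but to [- mx j], less than -1, with [uhat j].
   Hence a weight can be assigned to [uhat j] without altering an existing one. *)
have uA : uhat j \notin A j.
  apply/negP => /(optimal_dot fgrad opt); rewrite run_dot_uhat//.
  by have := run_mx_gt1 j0; lra.
have al : affine (l j) by case: opt => B [[]].
pose lam' v := if v == uhat j then t * M0 else lam j v.
have lamE v : v \in A j -> lam' v = lam j v.
  by rewrite /lam'; case: eqP => // ->; rewrite (negbTE uA).
have [[_ _ hmin] uE AE] := run_step hrun j0.
have wE : wt j.+1 = weight (uhat j |` A j)%fset (lam j.+1).
  by rewrite AE weight_prune.
rewrite wE uE; apply: le_trans (hmin lam' (l j) _ al) _.
  move=> v; rewrite !inE => /orP[/eqP ->|vA]; first by rewrite /lam' eqxx mulr_ge0.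
  by rewrite lamE// ltW// (optimal_gt0 opt).
have -> : combination (uhat j |` A j)%fset lam' (l j) = u j + (t * M0) *: uhat j.
  rewrite /combination big_fsetU1//= {1}/lam' eqxx.
  have -> : u j = combination (A j) (lam j) (l j) by case: opt.
  have -> : \sum_(v <- A j) lam' v *: v = \sum_(v <- A j) lam j v *: v.
    by apply: eq_big_seq => v vA; rewrite lamE.
  by rewrite -addrA [LHS]addrC.
have -> : weight (uhat j |` A j)%fset lam' = t * M0 + wt j.
  rewrite /weight big_fsetU1//= {1}/lam' eqxx; congr (_ + _).
  by apply: eq_big_seq => v vA; rewrite lamE.
have := descent fgrad lip (u j) ((t * M0) *: uhat j).
rewrite dotZr run_dot_uhat// normrZ.
have : (`|t * M0| * `|uhat j|) ^+ 2 <= (t * C) ^+ 2.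
  rewrite ler_sqr ?nnegrE ?mulr_ge0 ?normr_ge0 ?(ltW C0)//.
  rewrite ger0_norm ?mulr_ge0// -mulrA; apply: ler_wpM2l => //; exact: hbound.
move=> /(ler_wpM2l (ltW (divr_gt0 Lf0 (ltr0n R 2)))).
move=> h1 h2; lra.
Qed.

Lemma run_weight_le j : (0 < j)%N -> wt j <= M0.
Proof.
by move=> /run_optimal/optimal_f0; have := f_ge (u j); lra.
Qed.

Lemma run_TGV_cert j : (0 < j)%N -> TGV_cert alpha beta (u j) (wt j).
Proof.
move=> j0; apply: optimal_cert (run_optimal j0) _ => // v; exact: run_cert.
Qed.

Lemma run_gap j : (0 < j)%N ->
  `|wt j - TGV T alpha beta (u j)| <= M0 * (mx j - 1).
Proof.
move=> j0; have cert := run_TGV_cert j0.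
have mx1 := run_mx_gt1 j0; have mx0 := lt_trans ltr01 mx1.
have h1 := TGV_le alpha0 beta0 cert.
have h2 : wt j <= mx j * TGV T alpha beta (u j).
  rewrite -[wt j]opprK -(optimal_dot_self fgrad (run_optimal j0)).
  apply: dot_le_TGV cert (run_affine j0) mx0 _ _ => //.
    by rewrite -ler_pdivrMr// le_max lexx.
  by rewrite -ler_pdivrMr// le_max lexx orbT.
have h3 := run_weight_le j0.
rewrite ger0_norm ?subr_ge0//.
(* By [h2] the gap is at most (mx - 1) TGV, and TGV is at most the weight, hence at most M0. *)
have h4 : (mx j - 1) * TGV T alpha beta (u j) <= (mx j - 1) * M0.
  by apply: ler_wpM2l; lra.
by rewrite (mulrC M0); lra.
Qed.

(** The values of J are bounded below by [- Cf], as TGV is nonnegative, so the infimum is a genuine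
    lower bound. Applied to the last iterate, it turns the telescoped decrease into the residual of
    the first. *)
Lemma minJ_le v t : TGV_cert alpha beta v t -> minJ alpha beta f <= f v + t.
Proof.
move=> cert; apply: le_trans (_ : J alpha beta f v <= _); last first.
  by rewrite lerD2l; exact: TGV_le.
apply: ge_inf; last by exists v => //; exact: TGV_cert_BV cert.
exists (- Cf) => _ [w _ <-]; rewrite /J -[- Cf]addr0.
by apply: lerD; [exact: f_ge|exact: TGV_ge0].
Qed.

Lemma run_sum n : \sum_(1 <= j < n.+1) (M0 * (mx j - 1)) ^+ 2 <=
  2 * (Lf * C ^+ 2) * (f (u 1%N) + wt 1 - (f (u n.+1) + wt n.+1)).
Proof.
have M00 : 0 <= M0 by have := f_ge 0; lra.
elim: n => [|n IH]; first by rewrite big_geq// subrr mulr0.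
rewrite big_nat_recr//=.
have step : (M0 * (mx n.+1 - 1)) ^+ 2 <=
    2 * (Lf * C ^+ 2) * (f (u n.+1) + wt n.+1 - (f (u n.+2) + wt n.+2)).
  apply: decrease_sqr; first by rewrite mulr_gt0// exprn_gt0.
    by rewrite mulr_ge0// subr_ge0 ltW// run_mx_gt1.
  by move=> t t0; exact: run_decrease.
apply: le_trans (lerD IH step) _; lra.
Qed.

Lemma run_min_violation (k : nat) : (0 < k)%N ->
  0 <= min_upto (fun j => violation alpha beta M0 (g j)) k /\
  k%:R * min_upto (fun j => violation alpha beta M0 (g j)) k ^+ 2 <=
  2 * (Lf * C ^+ 2) * residual alpha beta f (u 1%N) (A 1%N) (lam 1%N).
Proof.
move=> k0; have M00 : 0 <= M0 by have := f_ge 0; lra.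
have viol_ge0 j : (0 < j)%N -> 0 <= violation alpha beta M0 (g j).
  by move=> j0; rewrite mulr_ge0// subr_ge0 ltW// run_mx_gt1.
set V := min_upto _ _; have V0 : 0 <= V.
  by apply: le_min_upto => // j /andP[j0 _]; exact: viol_ge0.
split=> //; apply: le_trans (_ : \sum_(1 <= j < k.+1) V ^+ 2 <= _).
  by rewrite sumr_const_nat subn1 mulr_natl.
apply: le_trans (_ : \sum_(1 <= j < k.+1) (M0 * (mx j - 1)) ^+ 2 <= _).
  apply: ler_sum_nat => j /andP[j0 jk]; rewrite ler_sqr ?nnegrE//.
    by apply: min_upto_le; rewrite j0.
  exact: viol_ge0.
apply: le_trans (run_sum k) _; apply: ler_wpM2l.
  by rewrite !mulr_ge0// ?exprn_ge0 ltW.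
rewrite /residual lerD2l lerN2; exact/minJ_le/run_TGV_cert.
Qed.

End run.

Theorem theorem8 (R : realType) (T alpha beta : R)
    (hT : 0 < T) (halpha : 0 < alpha) (hbeta : 0 < beta)
    (f : L2 T -> R) (grad : L2 T -> L2 T)
    (A1_diff : is_gradient f grad) (A1_cont : continuous grad)
    (Lf : R) (hLf : 0 < Lf)
    (A2 : forall u1 u2 : L2 T, `|grad u1 - grad u2| <= Lf * `|u1 - u2|)
    (Cf : R) (hCf : 0 < Cf)
    (A3 : forall u : L2 T, - Cf <= f u)
    (A4 : sublevel_sets_bounded alpha beta f)
    (A : nat -> {fset L2 T}) (lam : nat -> L2 T -> R)
    (l u uhat : nat -> L2 T) (xS xK : nat -> R)
    (hrun : infinite_run alpha beta f grad A lam l u uhat xS xK)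
    (C : R) (hC : 0 < C)
    (hbound : forall k, (0 < k)%N ->
       Num.max `|u k| ((f 0 + Cf) * `|uhat k|) <= C)
    (k : nat) (hk : (0 < k)%N) :
  min_upto (fun j => violation alpha beta (f 0 + Cf) (grad (u j))) k +
  min_upto (fun j => `|weight (A j) (lam j) - TGV T alpha beta (u j)|) k <=
  Num.sqrt (8 * Lf * C ^+ 2 *
            residual alpha beta f (u 1%N) (A 1%N) (lam 1%N) / k%:R).
Proof.
have hb j : (0 < j)%N -> (f 0 + Cf) * `|uhat j| <= C.
  by move=> /hbound; rewrite ge_max => /andP[].
have [V0 Vsqr] := run_min_violation hT halpha hbeta A1_diff hLf A2 A3 hrun hC hb hk.
set V := min_upto (fun j => violation _ _ _ _) k in V0 Vsqr *.
(* The two minima may be attained at different indices; the bound at each index suffices to compare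
   them. *)
have gapV : min_upto (fun j => `|weight (A j) (lam j) - TGV T alpha beta (u j)|) k <= V.
  apply: le_min_upto => // j /andP[j0 jk].
  apply: le_trans (run_gap hT halpha hbeta A1_diff A3 hrun j0).
  by apply: min_upto_le; rewrite j0.
apply: le_trans (lerD (lexx V) gapV) _.
have V2 : 0 <= V + V by rewrite addr_ge0.
rewrite -[leLHS](ger0_norm V2) -sqrtr_sqr; apply: ler_wsqrtr.
(* Squaring 2V brings a factor 4 to the bound 2 Lf C^2 r on k V^2, which gives the constant 8. *)
rewrite ler_pdivlMr ?ltr0n//; move: Vsqr; rewrite -mulr2n; lra.
Qed.
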